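(* Let $(P,S,D,f,\mathbf{E}^+,\mathbf{E}^-)$ be a sketched answer set problem: $P$ is a (stratified) sketched answer set program with set of sketched variables $S$, $D$ is the family of domains of the sketched variables, $f$ is a preference function, and $\mathbf{E}^+$ and $\mathbf{E}^-$ are finite sets of positive and negative examples. Let $T$ be the (non-sketched) answer set program obtained by the rewriting $\mathit{metaE}(P,S,\mathbf{E}^+,\mathbf{E}^-)\cup \mathit{metaD}(S,D)\cup \mathit{metaR}(S,D)\cup \mathit{metaC}(P)$ described in the context. Then there exists a satisfying substitution $\theta:S\to D$ (that is, one such that $P\theta\cup e$ has an answer set for every $e\in\mathbf{E}^+$ and $P\theta\cup e$ has no answer set for every $e\in\mathbf{E}^-$) if and only if $T$ has an answer set.
   Context: **ASP.** An (ordinary) program is a finite set of rules $a \leftarrow a_1,\dots,a_k,\mathit{not}\ a_{k+1},\dots,\mathit{not}\ a_n$ with $a$ and the $a_i$ atoms $p(t_1,\dots,t_m)$ whose terms $t_j$ are variables or constants (integers included); built-in comparisons and integer arithmetic may be used. A rule with empty body is a fact; a rule with no head (head $\bot$) is an integrity constraint. A rule with variables stands for the set of its ground instances. Answer sets are stable models (Gelfond–Lifschitz). A choice expression $1\,\{a(X):l(X)\}\,1$ used as a rule head means that exactly one of the atoms $a(c)$ with $l(c)$ true is chosen to be true. The usual safety conventions of ASP (as in Potassco/clingo) apply. **Sketched programs.** A sketched program $P$ is a finite set of rules of the form $a \leftarrow a_1,\dots,a_k,\mathit{not}\ a_{k+1},\dots,\mathit{not}\ a_n$ (facts and integrity constraints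 included, built-in comparisons and integer arithmetic allowed, but no choice rules) in which in addition the following sketched constructs may be used: - sketched atoms $?q(t_1,\dots,t_n)$, where $?q$ is a sketched predicate variable with a finite domain $d_q$ of ordinary predicates of arity $n$; these may be used in the same places as any other atom; - sketched inequality $X\ ?{=}\ Y$, with domain $\{=,\neq,<,>,\geq,\leq,\top\}$, where $\top$ is always true; - sketched arithmetic $X\ ?{+}\ Y$, with domain $\{+,-,\times,\div,\mathit{dist}\}$, where $\mathit{dist}(a,b)=|a-b|$; - sketched negation $?\mathit{not}\ A$ applied to an atom $A$ (possibly itself a sketched atom), with domain $\{\emptyset,\mathit{not}\}$, i.e. meaning either $A$ or $\mathit{not}\ A$. The set $S$ of sketched variables consists of the sketched predicates, sketched negations, sketched inequalities and sketched arithmetic operators of $P$ (each occurrence of $?{=}$, $?{+}$, $?\mathit{not}$ is a sketched variable of its own); $D_s$ denotes the domain of $s\in S$. A substitution $\theta:S\to D$ assigns to every $s\in S$ an element $\theta(s)\in D_s$; $P\theta$ is the ordinary program obtained by replacing each sketched variable by its value. **Dependency and stratification.** Predicate $p$ directly positively (negatively) depends on $q$ iff $q$ occurs positively (negatively) in the body of a rule with $p$ in the head, or $p$ is a sketched predicate and $q$ is in its domain (a positive dependency); an atom under $?\mathit{not}$ counts as occurring both positively and negatively. ''Depends on'' is the transitive closure of direct dependency. $P$ is stratified iff there is no cyclic dependency involving a negative direct dependency. Sketched programs are assumed stratified. **Examples and preferences.** An example is a finite set of ground atoms; $P\theta\cup e$ is $P\theta$ with the atoms of $e$ added as facts. A preference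 $f$ is an integer-valued function on substitutions (assignments $s\mapsto d$); it does not enter into the notion of satisfying substitution or into the rewriting. **The rewriting.** Enumerate all examples of $\mathbf{E}^+\cup\mathbf{E}^-$ (as labelled positive or negative) with distinct identifiers $i$. All auxiliary predicate names ($\mathit{examples},\mathit{positive},\mathit{negative},\mathit{negsat},\mathit{decision}\_s,\mathit{reified}\_s,\mathit{dom}\_s$) are new. $T$ is obtained by applying the following four transformations together. *metaE (example identifiers).* Let $\mathit{SP}$ be the set of all predicates (including sketched predicates) occurring in some example or depending on a predicate occurring in some example. (1) Replace each literal over a predicate $p\in \mathit{SP}$, $p(t_1,\dots,t_n)$, in $P$ by $p(E,t_1,\dots,t_n)$, where $E$ is a variable not otherwise occurring in $P$ (the same $E$ throughout a rule). (2) Add the guard $\mathit{examples}(E)$ to the body of each rule, where $\mathit{examples}(i)$ is a fact for every example identifier $i$. (3) For each atom $p(t_1,\dots,t_n)$ of the $i$-th example add the fact $p(i,t_1,\dots,t_n)$. (4) For each positive example $i$ add the fact $\mathit{positive}(i)$, for each negative one the fact $\mathit{negative}(i)$. *metaD (substitution generation).* For each $s\in S$ add the choice rule $1\,\{\mathit{decision}\_s(X):\mathit{dom}\_s(X)\}\,1$ and the facts $\mathit{dom}\_s(v)$ for all $v\in D_s$ (elements of $D_s$ being used as constants). *metaR (predicate reification).* (1) Replace each occurrence of a sketched atom $s(t_1,\dots,t_n)$ in a rule by $\mathit{reified}\_s(V,t_1,\dots,t_n)$ with $V$ a fresh variable, and add $\mathit{decision}\_s(V)$ to the body of that rule. (2)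 For each sketched predicate $s$ and each $d\in D_s$ add the rule $\mathit{reified}\_s(d,X_1,\dots,X_n)\leftarrow d(X_1,\dots,X_n)$. If $s\in\mathit{SP}$, the reified atom carries $E$ as an additional first argument, and so do those atoms in these rules whose predicate is in $\mathit{SP}$, with the guard $\mathit{examples}(E)$ in the body (thus e.g. $\mathit{reified}\_s(E,d,\bar X)\leftarrow d(E,\bar X),\mathit{examples}(E)$ if $d\in\mathit{SP}$, and $\mathit{reified}\_s(E,d,\bar X)\leftarrow d(\bar X),\mathit{examples}(E)$ if $s\in\mathit{SP}$ but $d\notin\mathit{SP}$). The other sketched constructs are treated in the same way: $X\ ?{=}\ Y$ becomes $\mathit{reified}\_s(V,X,Y)$ with, for each $d$ in its domain, $\mathit{reified}\_s(d,X,Y)$ derivable exactly for the pairs of ground terms with $X\ d\ Y$; $X\ ?{+}\ Y$ becomes a new variable $Z$ with the atom $\mathit{reified}\_s(V,X,Y,Z)$ in the body, where $\mathit{reified}\_s(d,X,Y,Z)$ is derivable exactly when $Z=X\ d\ Y$; and $?\mathit{not}\ A(\bar t)$ becomes $\mathit{reified}\_s(V,\bar t)$ with rules $\mathit{reified}\_s(\mathit{pos},\bar X)\leftarrow A(\bar X)$ and $\mathit{reified}\_s(\mathit{neg},\bar X)\leftarrow \mathit{not}\ A(\bar X),\ \mathit{dom}(\bar X)$, where $\mathit{dom}$ ranges over the relevant ground terms and $\mathit{pos},\mathit{neg}$ encode the domain values $\emptyset,\mathit{not}$ (with the extra argument $E$ and guard $\mathit{examples}(E)$ if the predicate of $A$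 is in $\mathit{SP}$; if $A$ is itself a sketched atom $?q(\bar t)$, then $A(\bar X)$ is its reified atom, and the decision argument of $q$ is carried along as a further argument of $\mathit{reified}\_s$). In each case $\mathit{decision}\_s(V)$ is added to the body of the rule where $s$ occurs. *metaC (integrity constraint splitting).* Replace each (already rewritten) integrity constraint $\leftarrow \mathit{body}$ by the two rules $\leftarrow \mathit{body},\mathit{positive}(E)$ and $\mathit{negsat}(E)\leftarrow \mathit{body},\mathit{negative}(E)$, and add the rule $\leftarrow \mathit{negative}(E),\mathit{not}\ \mathit{negsat}(E)$.
   Formalization: Sketched atoms are not allowed in rule heads: with them the claim fails, e.g. P = {?q(a). ← p(a).}, domain of ?q = {p}, one empty positive example, no negative ones: no satisfying substitution exists, but T has an answer set. *)

(* Defs.v *)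
From Stdlib Require Import String List ZArith Relations ClassicalEpsilon.
Import ListNotations.
Open Scope list_scope.
Set Implicit Arguments.

(* Ground terms are the integers and the symbolic constants.  Rules are grounded
   over all of them; for safe programs this gives the same answer sets as
   grounding over the constants of the program. *)
Inductive const := Num (z : Z) | Sym (c : string).

Inductive aop := Add | Sub | Mul | Div | Dist.
Inductive cmp := CEq | CNe | CLt | CGt | CGe | CLe | CTop.

(* [None] is an undefined operation; division truncates. *)
Definition aop_eval (o : aop) (a b : Z) : option Z :=
  match o with
  | Add => Some (a + b)%Z
  | Sub => Some (a - b)%Z
  | Mul => Some (a * b)%Z
  | Div => if Z.eqb b 0 then None else Some (Z.quot a b)
  | Dist => Some (Z.abs (a - b))
  end.

(* The total order of ground terms: integers precede symbolic constants. *)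
Definition const_compare (c d : const) : comparison :=
  match c, d with
  | Num a, Num b => Z.compare a b
  | Num _, Sym _ => Lt
  | Sym _, Num _ => Gt
  | Sym a, Sym b => String.compare a b
  end.

Definition cmp_eval (o : cmp) (c d : const) : bool :=
  match o, const_compare c d with
  | CTop, _ => true
  | CEq, Eq | CLe, Eq | CGe, Eq => true
  | CNe, Lt | CLt, Lt | CLe, Lt => true
  | CNe, Gt | CGt, Gt | CGe, Gt => true
  | _, _ => false
  end.

(* Programs over predicate symbols [N] and variables [V].  Ground atoms pair a
   symbol with its arguments, so a symbol used at two arities stands for two
   different predicates. *)
Inductive term (V : Type) :=
| Var (x : V)
| Cst (c : const)
| Bin (o : aop) (t u : term V).
Arguments Cst {V} c.

Record atom (N V : Type) := Atom { aname : N; aargs : list (term V) }.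

Inductive lit (N V : Type) :=
| Pos (a : atom N V)
| Neg (a : atom N V)
| Cmp (o : cmp) (t u : term V).
Arguments Cmp {N V} o t u.

(* [HChoice a l] is the choice expression 1 {a(X) : l(X)} 1. *)
Inductive head (N V : Type) :=
| HAtom (a : atom N V)
| HBot
| HChoice (a l : N).
Arguments HBot {N V}.
Arguments HChoice {N V} a l.

Record rule (N V : Type) := Rule { rhead : head N V; rbody : list (lit N V) }.

Definition program (N V : Type) := list (rule N V).

Definition gatom (N : Type) : Type := (N * list const)%type.

Inductive ghead (N : Type) :=
| GAtom (a : gatom N)
| GBot
| GChoice (a l : N).
Arguments GBot {N}.

Record grule (N : Type) :=
  GRule { grhead : ghead N; grpos : list (gatom N); grneg : list (gatom N) }.

Fixpoint eval (V : Type) (sigma : V -> const) (t : term V) : option const :=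
  match t with
  | Var x => Some (sigma x)
  | Cst c => Some c
  | Bin o t u =>
      match eval sigma t, eval sigma u with
      | Some (Num a), Some (Num b) => option_map Num (aop_eval o a b)
      | _, _ => None
      end
  end.

Fixpoint eval_list (V : Type) (sigma : V -> const) (ts : list (term V))
  : option (list const) :=
  match ts with
  | [] => Some []
  | t :: ts' =>
      match eval sigma t, eval_list sigma ts' with
      | Some c, Some cs => Some (c :: cs)
      | _, _ => None
      end
  end.

Definition ground_atom (N V : Type) (sigma : V -> const) (a : atom N V)
  : option (gatom N) :=
  option_map (fun cs => (aname a, cs)) (eval_list sigma (aargs a)).

(* Comparisons are evaluated away; the result is [None] when one of them is false
   or when some term is undefined, and the rule instance is then discarded. *)
Fixpoint ground_body (N V : Type) (sigma : V -> const) (b : list (lit N V))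
  : option (list (gatom N) * list (gatom N)) :=
  match b with
  | [] => Some ([], [])
  | l :: b' =>
      match ground_body sigma b' with
      | None => None
      | Some (ps, ns) =>
          match l with
          | Pos a => option_map (fun g => (g :: ps, ns)) (ground_atom sigma a)
          | Neg a => option_map (fun g => (ps, g :: ns)) (ground_atom sigma a)
          | Cmp o t u =>
              match eval sigma t, eval sigma u with
              | Some c, Some d => if cmp_eval o c d then Some (ps, ns) else None
              | _, _ => None
              end
          end
      end
  end.

Definition ground_head (N V : Type) (sigma : V -> const) (h : head N V)
  : option (ghead N) :=
  match h with
  | HAtom a => option_map (@GAtom N) (ground_atom sigma a)
  | HBot => Some GBot
  | HChoice a l => Some (GChoice a l)
  end.

Definition ground_rule (N V : Type) (sigma : V -> const) (r : rule N V)
  : option (grule N) :=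
  match ground_head sigma (rhead r), ground_body sigma (rbody r) with
  | Some h, Some (ps, ns) => Some (GRule h ps ns)
  | _, _ => None
  end.

Definition instance (N V : Type) (P : program N V) (g : grule N) : Prop :=
  exists r sigma, In r P /\ ground_rule sigma r = Some g.

Definition interp (N : Type) := gatom N -> Prop.

(* The Gelfond-Lifschitz reduct, as a set of definite rules and constraints (head
   [None]).  A choice contributes a definite rule for each chosen atom. *)
Inductive reduct (N V : Type) (P : program N V) (M : interp N)
  : option (gatom N) -> list (gatom N) -> Prop :=
| reduct_atom a ps ns :
    instance P (GRule (GAtom a) ps ns) -> (forall b, In b ns -> ~ M b) ->
    reduct P M (Some a) ps
| reduct_bot ps ns :
    instance P (GRule GBot ps ns) -> (forall b, In b ns -> ~ M b) ->
    reduct P M None ps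
| reduct_choice a l c ps ns :
    instance P (GRule (GChoice a l) ps ns) -> (forall b, In b ns -> ~ M b) ->
    M (a, [c]) ->
    reduct P M (Some (a, [c])) ((l, [c]) :: ps).

Definition is_model (N : Type) (J : interp N)
  (R : option (gatom N) -> list (gatom N) -> Prop) : Prop :=
  forall h ps, R h ps -> (forall b, In b ps -> J b) ->
  match h with Some a => J a | None => False end.

Definition choice_bounds (N V : Type) (P : program N V) (M : interp N) : Prop :=
  forall a l ps ns, instance P (GRule (GChoice a l) ps ns) ->
  (forall b, In b ps -> M b) -> (forall b, In b ns -> ~ M b) ->
  exists! c, M (l, [c]) /\ M (a, [c]).

Definition answer_set (N V : Type) (P : program N V) (M : interp N) : Prop :=
  choice_bounds P M /\
  is_model M (reduct P M) /\
  forall J : interp N, (forall a, J a -> M a) -> is_model J (reduct P M) ->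
  forall a, M a -> J a.

Definition fact (N V : Type) (n : N) (cs : list const) : rule N V :=
  Rule (HAtom (Atom n (map Cst cs))) [].
Arguments fact {N} V n cs.

(* Sketched variables.  Sketched predicates are identified by name and arity; each
   occurrence of ?=, ?+ and ?not carries an identifier of its own. *)
Inductive svar :=
| SPred (q : string) (n : nat)
| SIneq (i : nat)
| SArith (i : nat)
| SNot (i : nat).

Inductive sterm :=
| SVar (x : string)
| SCst (c : const)
| SBin (o : aop) (t u : sterm)
| SkBin (i : nat) (t u : sterm).

Inductive sname := Ord (p : string) | Sk (q : string).

Record satom := SAtom { saname : sname; saargs : list sterm }.

Inductive sign := Plain | Not | SkNot (i : nat).

Inductive slit :=
| SLit (s : sign) (a : satom)
| SCmp (o : cmp) (t u : sterm)
| SkCmp (i : nat) (t u : sterm).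

Record srule := SRule { shead : option satom; sbody : list slit }.

Definition sprogram := list srule.

Inductive nval := NotAbsent | NotPresent.

(* A value of [SPred q n] is the name of a predicate of arity [n]. *)
Definition value (s : svar) : Type :=
  match s with
  | SPred _ _ => string
  | SIneq _ => cmp
  | SArith _ => aop
  | SNot _ => nval
  end.

Definition subst := forall s : svar, value s.

(* The domains of the sketched predicates; the other domains are fixed. *)
Definition pdomains := string -> nat -> list string.

Definition domain (D : pdomains) (s : svar) : list (value s) :=
  match s with
  | SPred q n => D q n
  | SIneq _ => [CEq; CNe; CLt; CGt; CGe; CLe; CTop]
  | SArith _ => [Add; Sub; Mul; Div; Dist]
  | SNot _ => [NotAbsent; NotPresent]
  end.

Fixpoint arith_occs (t : sterm) : list (nat * sterm * sterm) :=
  match t with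
  | SVar _ | SCst _ => []
  | SBin _ t u => arith_occs t ++ arith_occs u
  | SkBin i t u => (i, t, u) :: arith_occs t ++ arith_occs u
  end.

Definition lit_terms (l : slit) : list sterm :=
  match l with
  | SLit _ a => saargs a
  | SCmp _ t u | SkCmp _ t u => [t; u]
  end.

Definition head_terms (h : option satom) : list sterm :=
  match h with Some a => saargs a | None => [] end.

Definition rule_arith_occs (r : srule) : list (nat * sterm * sterm) :=
  flat_map arith_occs (head_terms (shead r) ++ flat_map lit_terms (sbody r)).

Definition atom_svars (a : satom) : list svar :=
  match saname a with
  | Ord _ => []
  | Sk q => [SPred q (length (saargs a))]
  end.

Definition lit_svars (l : slit) : list svar :=
  match l with
  | SLit (SkNot i) a => SNot i :: atom_svars a
  | SLit _ a => atom_svars a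
  | SCmp _ _ _ => []
  | SkCmp i _ _ => [SIneq i]
  end.

Definition head_svars (h : option satom) : list svar :=
  match h with Some a => atom_svars a | None => [] end.

Definition rule_svars (r : srule) : list svar :=
  head_svars (shead r) ++ flat_map lit_svars (sbody r) ++
  map (fun o => SArith (fst (fst o))) (rule_arith_occs r).

(* The set S of sketched variables, listed with one entry per occurrence. *)
Definition svars (P : sprogram) : list svar := flat_map rule_svars P.

Definition is_pred_svar (s : svar) : bool :=
  match s with SPred _ _ => true | _ => false end.

Definition distinct_occurrences (P : sprogram) : Prop :=
  NoDup (filter (fun s => negb (is_pred_svar s)) (svars P)).

(* The rewriting derives reified_s atoms from atoms over the domain of s and never
   the other way round, so it accounts for sketched atoms in bodies only.  For
   instance, ?q(a) with domain {p} together with the constraint <- p(a) and the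
   empty positive example has no satisfying substitution, but p(a) would not be
   derivable in the rewritten program. *)
Definition ordinary_heads (P : sprogram) : Prop :=
  forall r a, In r P -> shead r = Some a -> exists p, saname a = Ord p.

Fixpoint term_inst (theta : subst) (t : sterm) : term string :=
  match t with
  | SVar x => Var x
  | SCst c => Cst c
  | SBin o t u => Bin o (term_inst theta t) (term_inst theta u)
  | SkBin i t u => Bin (theta (SArith i)) (term_inst theta t) (term_inst theta u)
  end.

Definition atom_inst (theta : subst) (a : satom) : atom string string :=
  Atom (match saname a with
        | Ord p => p
        | Sk q => theta (SPred q (length (saargs a)))
        end)
       (map (term_inst theta) (saargs a)).

Definition lit_inst (theta : subst) (l : slit) : lit string string :=
  match l with
  | SLit Plain a => Pos (atom_inst theta a)
  | SLit Not a => Neg (atom_inst theta a)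
  | SLit (SkNot i) a =>
      match (theta (SNot i) : nval) with
      | NotAbsent => Pos (atom_inst theta a)
      | NotPresent => Neg (atom_inst theta a)
      end
  | SCmp o t u => Cmp o (term_inst theta t) (term_inst theta u)
  | SkCmp i t u => Cmp (theta (SIneq i)) (term_inst theta t) (term_inst theta u)
  end.

Definition rule_inst (theta : subst) (r : srule) : rule string string :=
  Rule (match shead r with Some a => HAtom (atom_inst theta a) | None => HBot end)
       (map (lit_inst theta) (sbody r)).

Definition prog_inst (theta : subst) (P : sprogram) : program string string :=
  map (rule_inst theta) P.

Definition example := list (gatom string).

Definition example_facts (e : example) : program string string :=
  map (fun a => fact string (fst a) (snd a)) e.

Definition is_substitution (P : sprogram) (D : pdomains) (theta : subst) : Prop :=
  forall s, In s (svars P) -> In (theta s) (domain D s).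

Definition satisfying (P : sprogram) (D : pdomains) (Ep En : list example)
  (theta : subst) : Prop :=
  is_substitution P D theta /\
  (forall e, In e Ep ->
     exists M, answer_set (prog_inst theta P ++ example_facts e) M) /\
  (forall e, In e En ->
     ~ exists M, answer_set (prog_inst theta P ++ example_facts e) M).

(* Predicates, ordinary or sketched, given by name and arity. *)
Inductive spred := POrd (p : string) (n : nat) | PSk (q : string) (n : nat).

Definition sname_pred (x : sname) (n : nat) : spred :=
  match x with Ord p => POrd p n | Sk q => PSk q n end.

Definition satom_pred (a : satom) : spred :=
  sname_pred (saname a) (length (saargs a)).

Inductive dep_pos (P : sprogram) (D : pdomains) : spred -> spred -> Prop :=
| dep_pos_body r h s a :
    In r P -> shead r = Some h -> In (SLit s a) (sbody r) -> s <> Not ->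
    dep_pos P D (satom_pred h) (satom_pred a)
| dep_pos_dom q n d :
    In (SPred q n) (svars P) -> In d (D q n) ->
    dep_pos P D (PSk q n) (POrd d n).

Inductive dep_neg (P : sprogram) : spred -> spred -> Prop :=
| dep_neg_body r h s a :
    In r P -> shead r = Some h -> In (SLit s a) (sbody r) -> s <> Plain ->
    dep_neg P (satom_pred h) (satom_pred a).

Definition depends (P : sprogram) (D : pdomains) : spred -> spred -> Prop :=
  clos_trans spred (fun p q => dep_pos P D p q \/ dep_neg P p q).

Definition stratified (P : sprogram) (D : pdomains) : Prop :=
  ~ exists p q, dep_neg P p q /\ (p = q \/ depends P D q p).

Definition occurs_in_examples (es : list example) (p : spred) : Prop :=
  exists e a, In e es /\ In a e /\ p = POrd (fst a) (length (snd a)).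

Definition in_SP (P : sprogram) (D : pdomains) (es : list example) (p : spred)
  : Prop :=
  exists q, occurs_in_examples es q /\ (p = q \/ depends P D p q).

(* Predicate symbols of the rewritten program.  [TOrd p n] is the predicate p/n of
   the sketched program, applied to n + 1 arguments if p/n is in SP. *)
Inductive tname :=
| TOrd (p : string) (n : nat)
| TExamples
| TPositive
| TNegative
| TNegsat
| TDecision (s : svar)
| TDom (s : svar)
| TReified (s : svar)
| TTerm.

(* Variables of the rewritten program: those of P, the example variable E, the
   decision variable of the occurrence of [s] in the [k]-th place of the rule, the
   result of an arithmetic operation, and X_1, X_2, ... of the reification rules. *)
Inductive tvar :=
| VOrig (x : string)
| VE
| VDec (k : nat) (s : svar)
| VRes (i : nat)
| VX (j : nat).

Definition tatom := atom tname tvar.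
Definition tlit := lit tname tvar.
Definition trule := rule tname tvar.
Definition tprogram := program tname tvar.

Definition cmp_const (o : cmp) : const :=
  Sym (match o with
       | CEq => "eq" | CNe => "ne" | CLt => "lt" | CGt => "gt"
       | CGe => "ge" | CLe => "le" | CTop => "top"
       end)%string.

Definition aop_const (o : aop) : const :=
  Sym (match o with
       | Add => "plus" | Sub => "minus" | Mul => "times" | Div => "div"
       | Dist => "dist"
       end)%string.

Definition nval_const (v : nval) : const :=
  Sym (match v with NotAbsent => "pos" | NotPresent => "neg" end)%string.

Definition val_const (s : svar) : value s -> const :=
  match s return value s -> const with
  | SPred _ _ => Sym
  | SIneq _ => cmp_const
  | SArith _ => aop_const
  | SNot _ => nval_const
  end.

Definition examples_lit : tlit := Pos (Atom TExamples [Var VE]).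

Definition decision_lit (k : nat) (s : svar) : tlit :=
  Pos (Atom (TDecision s) [Var (VDec k s)]).

Definition e_arg (SP : spred -> Prop) (p : spred) : list (term tvar) :=
  if excluded_middle_informative (SP p) then [Var VE] else [].

Definition e_guard (SP : spred -> Prop) (p : spred) : list tlit :=
  if excluded_middle_informative (SP p) then [examples_lit] else [].

Fixpoint rw_term (t : sterm) : term tvar :=
  match t with
  | SVar x => Var (VOrig x)
  | SCst c => Cst c
  | SBin o t u => Bin o (rw_term t) (rw_term u)
  | SkBin i _ _ => Var (VRes i)
  end.

(* The decision argument of the sketched predicate of an atom, if any. *)
Definition dec_arg (k : nat) (x : sname) (n : nat) : list (term tvar) :=
  match x with
  | Ord _ => []
  | Sk q => [Var (VDec k (SPred q n))]
  end.

Definition rw_app (SP : spred -> Prop) (k : nat) (x : sname)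
  (ts : list (term tvar)) : tatom :=
  let n := length ts in
  Atom (match x with Ord p => TOrd p n | Sk q => TReified (SPred q n) end)
       (e_arg SP (sname_pred x n) ++ dec_arg k x n ++ ts).

Definition rw_atom (SP : spred -> Prop) (k : nat) (a : satom) : tatom :=
  rw_app SP k (saname a) (map rw_term (saargs a)).

Definition rw_lit (SP : spred -> Prop) (k : nat) (l : slit) : tlit :=
  match l with
  | SLit Plain a => Pos (rw_atom SP k a)
  | SLit Not a => Neg (rw_atom SP k a)
  | SLit (SkNot i) a =>
      Pos (Atom (TReified (SNot i))
             (e_arg SP (satom_pred a) ++ Var (VDec k (SNot i)) ::
              dec_arg k (saname a) (length (saargs a)) ++
              map rw_term (saargs a)))
  | SCmp o t u => Cmp o (rw_term t) (rw_term u)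
  | SkCmp i t u =>
      Pos (Atom (TReified (SIneq i))
             [Var (VDec k (SIneq i)); rw_term t; rw_term u])
  end.

Definition arith_lits (o : nat * sterm * sterm) : list tlit :=
  let '(i, t, u) := o in
  [Pos (Atom (TReified (SArith i))
          [Var (VDec 0 (SArith i)); rw_term t; rw_term u; Var (VRes i)]);
   decision_lit 0 (SArith i)].

(* The head is in place 0 and the body literals are in places 1, 2, ... *)
Definition rw_body (SP : spred -> Prop) (r : srule) : list tlit :=
  let ls := combine (seq 1 (length (sbody r))) (sbody r) in
  map (fun '(k, l) => rw_lit SP k l) ls ++
  map (decision_lit 0) (head_svars (shead r)) ++
  flat_map (fun '(k, l) => map (decision_lit k) (lit_svars l)) ls ++
  flat_map arith_lits (rule_arith_occs r) ++
  [examples_lit].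

(* The rewritten rule of [r]; a constraint becomes the two rules of the splitting. *)
Definition rw_rule (SP : spred -> Prop) (r : srule) : list trule :=
  match shead r with
  | Some a => [Rule (HAtom (rw_atom SP 0 a)) (rw_body SP r)]
  | None =>
      [Rule HBot (rw_body SP r ++ [Pos (Atom TPositive [Var VE])]);
       Rule (HAtom (Atom TNegsat [Var VE]))
            (rw_body SP r ++ [Pos (Atom TNegative [Var VE])])]
  end.

Definition negsat_constraint : trule :=
  Rule HBot [Pos (Atom TNegative [Var VE]); Neg (Atom TNegsat [Var VE])].

Definition labelled_examples (Ep En : list example)
  : list (nat * (bool * example)) :=
  let es := map (pair true) Ep ++ map (pair false) En in
  combine (seq 0 (length es)) es.

Definition example_rules (x : nat * (bool * example)) : list trule :=
  let '(i, (b, e)) := x in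
  let id := Num (Z.of_nat i) in
  [fact tvar TExamples [id]; fact tvar (if b then TPositive else TNegative) [id]] ++
  map (fun a : gatom string =>
         fact tvar (TOrd (fst a) (length (snd a))) (id :: snd a)) e.

Definition generation_rules (D : pdomains) (s : svar) : list trule :=
  Rule (HChoice (TDecision s) (TDom s)) [] ::
  map (fun v => fact tvar (TDom s) [val_const s v]) (domain D s).

Definition xs (n : nat) : list (term tvar) := map (fun j => Var (VX j)) (seq 1 n).

Definition reify_rules (SP : spred -> Prop) (D : pdomains) (s : svar)
  : list trule :=
  match s with
  | SPred q n =>
      map (fun d : string =>
        Rule (HAtom (Atom (TReified s)
                       (e_arg SP (PSk q n) ++ Cst (Sym d) :: xs n)))
             (Pos (rw_app SP 0 (Ord d) (xs n)) :: e_guard SP (PSk q n)))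
        (D q n)
  | SIneq i =>
      map (fun d : cmp =>
        Rule (HAtom (Atom (TReified s)
                       [Cst (cmp_const d); Var (VX 1); Var (VX 2)]))
             [Cmp d (Var (VX 1)) (Var (VX 2))])
        (domain D (SIneq i))
  | SArith i =>
      map (fun d : aop =>
        Rule (HAtom (Atom (TReified s)
                       [Cst (aop_const d); Var (VX 1); Var (VX 2); Var (VX 3)]))
             [Cmp CEq (Var (VX 3)) (Bin d (Var (VX 1)) (Var (VX 2)))])
        (domain D (SArith i))
  | SNot _ => []
  end.

(* The relevant ground terms are taken to be all ground terms. *)
Definition term_rule : trule := Rule (HAtom (Atom TTerm [Var (VX 1)])) [].

Definition reify_not_rules (SP : spred -> Prop) (l : slit) : list trule :=
  match l with
  | SLit (SkNot i) a =>
      let n := length (saargs a) in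
      let p := satom_pred a in
      let args := dec_arg 0 (saname a) n ++ xs n in
      let lifted v :=
        HAtom (Atom (TReified (SNot i))
                 (e_arg SP p ++ Cst (nval_const v) :: args)) in
      let body_atom := rw_app SP 0 (saname a) (xs n) in
      [Rule (lifted NotAbsent) (Pos body_atom :: e_guard SP p);
       Rule (lifted NotPresent)
            (Neg body_atom :: map (fun t => Pos (Atom TTerm [t])) args ++
             e_guard SP p)]
  | _ => []
  end.

Definition rewriting (P : sprogram) (D : pdomains) (Ep En : list example)
  : tprogram :=
  let SP := in_SP P D (Ep ++ En) in
  flat_map (rw_rule SP) P ++
  flat_map example_rules (labelled_examples Ep En) ++
  flat_map (generation_rules D) (svars P) ++
  flat_map (reify_rules SP D) (svars P) ++
  flat_map (fun r => flat_map (reify_not_rules SP) (sbody r)) P ++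
  [term_rule; negsat_constraint].

(* Main.v *)
(* The answer sets of the rewriting are assembled from those of the programs
   [P theta + e].  For a stratified program the definite part has exactly one stable
   model: the operator sending an interpretation of negation to the least model of the
   reduct determines one more negation depth at each iteration, and depths are bounded.
   Hence [P theta + e] has no answer set iff its stable model violates a constraint,
   which is what [negsat] records.  Given [theta], the stable models for the examples
   agree on the predicates outside SP, so they glue to one interpretation of the
   rewriting.  Conversely, an answer set [M] decides a [theta] and projects, for each
   identifier [i], to [A i]; gluing the least models [B i] of the reducts of
   [P theta + e_i] by [A i] gives a model of the reduct of the rewriting by [M],
   so minimality of [M] yields [A i <= B i], and [A i] is stable. *)
From Stdlib Require Import String.
Require Import Defs.
From Stdlib Require Import List ZArith Relations Lia.
From Stdlib Require Import FunctionalExtensionality PropExtensionality.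
From Stdlib Require Import Classical ClassicalEpsilon.
Import ListNotations.
Set Implicit Arguments.


(** * Answer sets as fixed points *)

(** The obstacle is that predicates outside [SP] carry no example argument: an atom over such a
    predicate, once derived for one example, is there for all. A family of interpretations can
    therefore be glued faithfully only if its members agree outside [SP], which is the predicate
    [coherent]. For the least models [B i] this agreement is not immediate; it is obtained from that
    of the [A i] and the fact that every atom of an example lies in [SP]. Gluing takes two families,
    one read under negation and one elsewhere, because [A i] and [B i] are known to coincide only
    after minimality has been used. Derivation is separated from the constraints throughout, so that
    least models exist even where a constraint is violated, as it must be in a negative example.
    Stratification is exploited only in the programs P theta + e; the dependencies among the
    predicates of the rewriting itself, with its choices and reified atoms, are never analysed. *)

(** Truth in [J] of the reduct by [M]: only negation looks at [M]. A literal with an undefined term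
    is false under either sign, which matches the discarded instances of [ground_body]. *)
Definition lit_holds (N V : Type) (J M : interp N) (sigma : V -> const)
  (l : lit N V) : Prop :=
  match l with
  | Pos a => exists g, ground_atom sigma a = Some g /\ J g
  | Neg a => exists g, ground_atom sigma a = Some g /\ ~ M g
  | Cmp o t u => exists c d,
      eval sigma t = Some c /\ eval sigma u = Some d /\ cmp_eval o c d = true
  end.

Definition body_holds (N V : Type) (J M : interp N) (sigma : V -> const)
  (b : list (lit N V)) : Prop := Forall (lit_holds J M sigma) b.

(** The definite part of the reduct, without its constraints. Closed interpretations are then stable
    under intersection whatever the constraints say, and [least] is always one of them. *)
Definition closed (N V : Type) (Q : program N V) (M J : interp N) : Prop :=
  (forall r h sigma g, In r Q -> rhead r = HAtom h ->
     ground_atom sigma h = Some g -> body_holds J M sigma (rbody r) -> J g) /\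
  (forall r a l sigma c, In r Q -> rhead r = HChoice a l ->
     body_holds J M sigma (rbody r) -> M (a, [c]) -> J (l, [c]) -> J (a, [c])).

Definition least (N V : Type) (Q : program N V) (M : interp N) : interp N :=
  fun g => forall J, closed Q M J -> J g.

Definition stable (N V : Type) (Q : program N V) (M : interp N) : Prop :=
  forall g, M g <-> least Q M g.

Definition constraints_hold (N V : Type) (Q : program N V) (M : interp N) : Prop :=
  forall r sigma, In r Q -> rhead r = HBot -> ~ body_holds M M sigma (rbody r).

Lemma lit_holds_mono (N V : Type) (J J' M M' : interp N) (sigma : V -> const) l :
  (forall g, J g -> J' g) -> (forall g, M' g -> M g) ->
  lit_holds J M sigma l -> lit_holds J' M' sigma l.
Proof.
  intros HJ HM; destruct l; simpl; auto; intros (g & E & H); exists g; auto.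
Qed.

Lemma body_holds_mono (N V : Type) (J J' M M' : interp N) (sigma : V -> const) b :
  (forall g, J g -> J' g) -> (forall g, M' g -> M g) ->
  body_holds J M sigma b -> body_holds J' M' sigma b.
Proof.
  intros HJ HM; apply Forall_impl; intros l; now apply lit_holds_mono.
Qed.

Lemma ground_body_holds (N V : Type) (J M : interp N) (sigma : V -> const) b :
  body_holds J M sigma b <->
  exists ps ns, ground_body sigma b = Some (ps, ns) /\
    (forall g, In g ps -> J g) /\ (forall g, In g ns -> ~ M g).
Proof.
  unfold body_holds; induction b as [|l b IH]; simpl.
  { split; [|constructor]. intros _; exists [], []; simpl; tauto. }
  rewrite Forall_cons_iff, IH; clear IH; split.
  - intros (Hl & ps & ns & -> & Hp & Hn); destruct l; simpl in Hl |- *.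
    + destruct Hl as (g & -> & Hg); exists (g :: ps), ns; simpl.
      repeat split; auto; intros ? [<-|]; auto.
    + destruct Hl as (g & -> & Hg); exists ps, (g :: ns); simpl.
      repeat split; auto; intros ? [<-|]; auto.
    + destruct Hl as (c & d & -> & -> & Ec); rewrite Ec; exists ps, ns; auto.
  - intros (ps & ns & E & Hp & Hn).
    destruct (ground_body sigma b) as [[ps' ns']|]; [|discriminate].
    destruct l; simpl.
    + destruct (ground_atom sigma a) as [g|]; simpl in E; [|discriminate].
      injection E as <- <-; simpl in Hp.
      split; [exists g | exists ps', ns']; auto.
    + destruct (ground_atom sigma a) as [g|]; simpl in E; [|discriminate].
      injection E as <- <-; simpl in Hn.
      split; [exists g | exists ps', ns']; auto.
    + destruct (eval sigma t) as [c|]; [|discriminate].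
      destruct (eval sigma u) as [d|]; [|discriminate].
      destruct (cmp_eval o c d) eqn:Ec; [|discriminate].
      injection E as <- <-; split; [exists c, d | exists ps', ns']; auto.
Qed.

(** Trades ground instances for pairs of a rule and a substitution, so that later arguments never
    handle lists of ground atoms. *)
Lemma instance_holds (N V : Type) (Q : program N V) (J M : interp N) gh :
  (exists ps ns, instance Q (GRule gh ps ns) /\
     (forall g, In g ps -> J g) /\ (forall g, In g ns -> ~ M g)) <->
  (exists r sigma, In r Q /\ ground_head sigma (rhead r) = Some gh /\
     body_holds J M sigma (rbody r)).
Proof.
  split.
  - intros (ps & ns & (r & sigma & Hr & E) & Hp & Hn); exists r, sigma.
    unfold ground_rule in E.
    destruct (ground_head sigma (rhead r)) as [h|]; [|discriminate].
    destruct (ground_body sigma (rbody r)) as [[ps' ns']|] eqn:Eb; [|discriminate].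
    injection E as -> -> ->; rewrite ground_body_holds; eauto 10.
  - intros (r & sigma & Hr & Eh & Hb).
    apply ground_body_holds in Hb as (ps & ns & Eb & Hp & Hn).
    exists ps, ns; split; [|auto]; exists r, sigma; split; [auto|].
    unfold ground_rule; now rewrite Eh, Eb.
Qed.

Lemma is_model_reduct (N V : Type) (Q : program N V) (J M : interp N) :
  is_model J (reduct Q M) <->
  closed Q M J /\
  (forall r sigma, In r Q -> rhead r = HBot -> ~ body_holds J M sigma (rbody r)).
Proof.
  split.
  - intros H; split; [split|].
    + intros r h sigma g Hr Eh Eg Hb.
      destruct (proj2 (instance_holds Q J M (GAtom g))) as (ps & ns & Hi & Hp & Hn).
      { exists r, sigma; rewrite Eh; simpl; rewrite Eg; auto. }
      exact (H (Some g) ps (reduct_atom M Hi Hn) Hp).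
    + intros r a l sigma c Hr Eh Hb HM HJ.
      destruct (proj2 (instance_holds Q J M (GChoice a l))) as (ps & ns & Hi & Hp & Hn).
      { exists r, sigma; rewrite Eh; auto. }
      apply (H (Some (a, [c])) _ (reduct_choice M c Hi Hn HM)).
      intros g [<-|]; auto.
    + intros r sigma Hr Eh Hb.
      destruct (proj2 (instance_holds Q J M GBot)) as (ps & ns & Hi & Hp & Hn).
      { exists r, sigma; rewrite Eh; auto. }
      exact (H None ps (reduct_bot M Hi Hn) Hp).
  - intros ((H1 & H2) & H3) h ps Hred Hp; destruct Hred as [a ps ns Hi Hn | ps ns Hi Hn | a l c ps ns Hi Hn HM].
    + destruct (proj1 (instance_holds Q J M (GAtom a))) as (r & s & Hr & Eh & Hb).
      { eauto 6. }
      destruct (rhead r) as [h| |] eqn:Er; try discriminate; simpl in Eh.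
      destruct (ground_atom s h) as [g|] eqn:Eg; [|discriminate].
      injection Eh as ->; eauto.
    + destruct (proj1 (instance_holds Q J M GBot)) as (r & s & Hr & Eh & Hb).
      { eauto 6. }
      destruct (rhead r) as [h| |] eqn:Er; try discriminate; simpl in Eh.
      * now destruct (ground_atom s h).
      * exact (H3 r s Hr Er Hb).
    + destruct (proj1 (instance_holds Q J M (GChoice a l))) as (r & s & Hr & Eh & Hb).
      { exists ps, ns; simpl in Hp; auto. }
      destruct (rhead r) as [h| |] eqn:Er; try discriminate; simpl in Eh.
      * now destruct (ground_atom s h).
      * injection Eh as -> ->. eapply H2; eauto; apply Hp; simpl; auto.
Qed.

Lemma least_closed (N V : Type) (Q : program N V) (M J : interp N) g :
  closed Q M J -> least Q M g -> J g.
Proof. intros HJ Hg; now apply Hg. Qed.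

Lemma closed_least (N V : Type) (Q : program N V) (M : interp N) :
  closed Q M (least Q M).
Proof.
  split.
  - intros r h sigma g Hr Eh Eg Hb J HJ.
    apply (proj1 HJ r h sigma g Hr Eh Eg).
    revert Hb; apply body_holds_mono; auto; intro; now apply least_closed.
  - intros r a l sigma c Hr Eh Hb HM Hl J HJ.
    apply (proj2 HJ r a l sigma c Hr Eh); auto.
    + revert Hb; apply body_holds_mono; auto; intro; now apply least_closed.
    + now apply (least_closed HJ).
Qed.

Lemma stable_closed (N V : Type) (Q : program N V) (M : interp N) :
  stable Q M -> closed Q M M.
Proof.
  intros HM; replace M with (least Q M) at 2; [apply closed_least|].
  extensionality g; apply propositional_extensionality; symmetry; apply HM.
Qed.

Lemma stable_of_closed (N V : Type) (Q : program N V) (M : interp N) :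
  closed Q M M -> (forall g, M g -> least Q M g) -> stable Q M.
Proof. intros Hc Hl g; split; [apply Hl|]; intros H; now apply H. Qed.

(** Minimality in [answer_set] ranges over models of the whole reduct, constraints included.
    Constraint bodies are positive in the reduct, so a subset of [M] inherits the constraints from
    [M], and minimality may be tested on the definite part alone. *)
Lemma answer_set_stable (N V : Type) (Q : program N V) (M : interp N) :
  answer_set Q M <-> choice_bounds Q M /\ stable Q M /\ constraints_hold Q M.
Proof.
  unfold answer_set; rewrite is_model_reduct; split.
  - intros (Hb & (Hc & Hi) & Hmin); split; [auto|split; [|exact Hi]].
    apply stable_of_closed; [auto|]; intros g HM.
    (* The competitor is the intersection of [M] with [least Q M]: it lies below [M], hence
       satisfies the constraints, and it is still closed. *)
    enough (M g /\ least Q M g) by tauto; revert g HM.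
    apply Hmin; [tauto|]; apply is_model_reduct; split; [split|].
    + intros r h s g Hr Eh Eg Hbd; split.
      * apply (proj1 Hc r h s g Hr Eh Eg); revert Hbd; apply body_holds_mono; tauto.
      * apply (proj1 (closed_least Q M) r h s g Hr Eh Eg).
        revert Hbd; apply body_holds_mono; tauto.
    + intros r a l s c Hr Eh Hbd HMc [HMl Hll]; split; [auto|].
      apply (proj2 (closed_least Q M) r a l s c Hr Eh); auto.
      revert Hbd; apply body_holds_mono; tauto.
    + intros r s Hr Eh Hbd; apply (Hi r s Hr Eh).
      revert Hbd; apply body_holds_mono; tauto.
  - intros (Hb & Hs & Hi); split; [auto|split; [split|]].
    + now apply stable_closed.
    + exact Hi.
    + intros J _ HJ g HM; apply Hs in HM; apply HM.
      now apply is_model_reduct in HJ.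
Qed.

Lemma choice_bounds_holds (N V : Type) (Q : program N V) (M : interp N) :
  choice_bounds Q M <->
  forall r a l sigma, In r Q -> rhead r = HChoice a l ->
    body_holds M M sigma (rbody r) -> exists! c, M (l, [c]) /\ M (a, [c]).
Proof.
  split.
  - intros H r a l s Hr Eh Hb.
    destruct (proj2 (instance_holds Q M M (GChoice a l))) as (ps & ns & Hi & Hp & Hn).
    { exists r, s; rewrite Eh; auto. }
    exact (H a l ps ns Hi Hp Hn).
  - intros H a l ps ns Hi Hp Hn.
    destruct (proj1 (instance_holds Q M M (GChoice a l))) as (r & s & Hr & Eh & Hb).
    { eauto 6. }
    destruct (rhead r) as [h| |] eqn:Er; try discriminate; simpl in Eh.
    + now destruct (ground_atom s h).
    + injection Eh as -> ->; eauto.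
Qed.


(** * Instances of a sketched program *)

Lemma eval_list_length (V : Type) (sigma : V -> const) ts cs :
  eval_list sigma ts = Some cs -> length cs = length ts.
Proof.
  revert cs; induction ts as [|t ts IH]; simpl; intros cs E.
  - now injection E as <-.
  - destruct (eval sigma t); [|discriminate].
    destruct (eval_list sigma ts); [|discriminate].
    injection E as <-; simpl; auto.
Qed.

Lemma eval_list_cst (V : Type) (sigma : V -> const) cs :
  eval_list sigma (map Cst cs) = Some cs.
Proof. induction cs as [|c cs IH]; simpl; [|rewrite IH]; auto. Qed.

Definition with_facts (theta : subst) (P : sprogram) (e : example)
  : program string string := prog_inst theta P ++ example_facts e.

(** Two interpretations are needed because [negsat] is itself derived in a reduct: the positive part
    of the violated body is read where atoms are derived, the negative part where negation was
    fixed. *)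
Definition violated (theta : subst) (P : sprogram) (J M : interp string) : Prop :=
  exists r sigma, In r P /\ shead r = None /\
    body_holds J M sigma (map (lit_inst theta) (sbody r)).

Lemma closed_with_facts theta P e (M J : interp string) :
  closed (with_facts theta P e) M J <->
  (forall r h sigma g, In r P -> shead r = Some h ->
     ground_atom sigma (atom_inst theta h) = Some g ->
     body_holds J M sigma (map (lit_inst theta) (sbody r)) -> J g) /\
  (forall g, In g e -> J g).
Proof.
  unfold with_facts, prog_inst, example_facts; split.
  - intros [H _]; split.
    + intros r h s g Hr Eh Eg Hb; apply (H (rule_inst theta r) (atom_inst theta h) s g).
      * apply in_or_app; left; now apply in_map.
      * simpl; now rewrite Eh.
      * exact Eg.
      * exact Hb.
    + intros [n cs] Hg.
      apply (H (Defs.fact string n cs) (Atom n (map Cst cs)) (fun _ => Num 0)); auto.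
      * apply in_or_app; right.
        now apply (in_map (fun a => Defs.fact string (fst a) (snd a)) e (n, cs)).
      * unfold ground_atom; simpl; now rewrite eval_list_cst.
      * constructor.
  - intros [H1 H2]; split.
    + intros r h s g Hr Eh Eg Hb.
      apply in_app_or in Hr as [Hr|Hr];
        apply in_map_iff in Hr as (r0 & <- & Hr0); simpl in Eh.
      * destruct (shead r0) as [h0|] eqn:E0; [|discriminate].
        injection Eh as <-; eauto.
      * injection Eh as <-; unfold ground_atom in Eg; simpl in Eg.
        rewrite eval_list_cst in Eg; simpl in Eg; injection Eg as <-.
        apply H2; now destruct r0.
    + intros r a l s c Hr Eh.
      apply in_app_or in Hr as [Hr|Hr];
        apply in_map_iff in Hr as (r0 & <- & Hr0); simpl in Eh; [|discriminate].
      now destruct (shead r0).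
Qed.

Lemma answer_set_with_facts theta P e (M : interp string) :
  answer_set (with_facts theta P e) M <->
  stable (with_facts theta P e) M /\ ~ violated theta P M M.
Proof.
  rewrite answer_set_stable, choice_bounds_holds.
  unfold constraints_hold, with_facts, prog_inst, example_facts; split.
  - intros (_ & Hs & Hc); split; [auto|]; intros (r & s & Hr & Eh & Hb).
    apply (Hc (rule_inst theta r) s); auto.
    + apply in_or_app; left; now apply in_map.
    + simpl; now rewrite Eh.
  - intros (Hs & Hv); split; [|split; [auto|]].
    + intros r a l s Hr Eh.
      apply in_app_or in Hr as [Hr|Hr];
        apply in_map_iff in Hr as (r0 & <- & Hr0); simpl in Eh; [|discriminate].
      now destruct (shead r0).
    + intros r s Hr Eh Hb.
      apply in_app_or in Hr as [Hr|Hr];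
        apply in_map_iff in Hr as (r0 & <- & Hr0); simpl in Eh; [|discriminate].
      destruct (shead r0) eqn:E0; [discriminate|].
      apply Hv; now exists r0, s.
Qed.

Definition gatom_pred (g : gatom string) : spred := POrd (fst g) (length (snd g)).

Lemma ground_atom_pred (sigma : string -> const) (a : atom string string) g :
  ground_atom sigma a = Some g -> gatom_pred g = POrd (aname a) (length (aargs a)).
Proof.
  unfold ground_atom; destruct (eval_list sigma (aargs a)) eqn:E; [|discriminate].
  intros [= <-]; unfold gatom_pred; simpl; now rewrite (eval_list_length _ _ E).
Qed.

(** * Dependencies of the instances and negation depth *)

Section Stratified.

Context (P : sprogram) (D : pdomains).

Definition reaches (p q : spred) : Prop := p = q \/ depends P D p q.

Lemma reaches_trans p q r : reaches p q -> reaches q r -> reaches p r.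
Proof.
  intros [->|H1] [->|H2]; unfold reaches; auto.
  right; eapply t_trans; eauto.
Qed.

Lemma depends_reaches p q r : depends P D p q -> reaches q r -> depends P D p r.
Proof. intros H1 [->|H2]; auto; eapply t_trans; eauto. Qed.

Lemma lit_svars_svars r l s :
  In r P -> In l (sbody r) -> In s (lit_svars l) -> In s (svars P).
Proof.
  intros Hr Hl Hs; apply in_flat_map; exists r; split; auto.
  unfold rule_svars; apply in_or_app; right; apply in_or_app; left.
  apply in_flat_map; eauto.
Qed.

Section Substitution.

Context (theta : subst) (Htheta : is_substitution P D theta).

(** The value chosen by [theta] lies in the domain, so passing from a sketched predicate to its
    value follows a dependency of [P]. Dependencies of every instance are thus controlled by those
    of the sketched program. *)
Lemma atom_inst_reaches r l sg a :
  In r P -> In l (sbody r) -> l = SLit sg a ->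
  reaches (satom_pred a)
    (POrd (aname (atom_inst theta a)) (length (aargs (atom_inst theta a)))).
Proof.
  intros Hr Hl ->; unfold satom_pred, sname_pred, atom_inst; simpl.
  rewrite length_map.
  destruct (saname a) as [p|q] eqn:E; [now left|right; apply t_step; left].
  assert (Hs : In (SPred q (length (saargs a))) (svars P)).
  { apply (lit_svars_svars _ _ _ Hr Hl); unfold lit_svars, atom_svars; rewrite E.
    destruct sg; simpl; auto. }
  constructor; auto; exact (Htheta _ Hs).
Qed.

Lemma lit_inst_pos_depends r h l a :
  In r P -> shead r = Some h -> In l (sbody r) -> lit_inst theta l = Pos a ->
  depends P D (satom_pred h) (POrd (aname a) (length (aargs a))).
Proof.
  intros Hr Eh Hl E; destruct l as [sg b| |]; try discriminate.
  assert (sg <> Not /\ a = atom_inst theta b) as [Hsg ->].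
  { destruct sg; simpl in E; try discriminate; [|destruct (theta (SNot i)); try discriminate];
      injection E as <-; split; congruence. }
  eapply depends_reaches; [|eapply atom_inst_reaches; eauto].
  apply t_step; left; eapply dep_pos_body; eauto.
Qed.

Lemma lit_inst_neg_depends r h l a :
  In r P -> shead r = Some h -> In l (sbody r) -> lit_inst theta l = Neg a ->
  exists q, dep_neg P (satom_pred h) q /\
    reaches q (POrd (aname a) (length (aargs a))).
Proof.
  intros Hr Eh Hl E; destruct l as [sg b| |]; try discriminate.
  assert (sg <> Plain /\ a = atom_inst theta b) as [Hsg ->].
  { destruct sg; simpl in E; try discriminate; [|destruct (theta (SNot i)); try discriminate];
      injection E as <-; split; congruence. }
  exists (satom_pred b); split; [|eapply atom_inst_reaches; eauto].
  eapply dep_neg_body; eauto.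
Qed.

End Substitution.

(* [descends ps p]: some path of dependencies from [p] passes through negative
   dependencies of all the predicates in [ps], in this order. *)
Inductive descends : list spred -> spred -> Prop :=
| descends_nil p : descends [] p
| descends_cons p p' q ps :
    reaches p p' -> dep_neg P p' q -> descends ps q -> descends (p' :: ps) p.

Definition depth_at_least (n : nat) (p : spred) : Prop :=
  exists ps, length ps = n /\ descends ps p.

Lemma depth_reaches n p q :
  reaches p q -> depth_at_least n q -> depth_at_least n p.
Proof.
  intros H (ps & E & Hps); exists ps; split; auto.
  destruct Hps; econstructor; eauto using reaches_trans.
Qed.

Lemma depth_neg n p p' q :
  reaches p p' -> dep_neg P p' q -> depth_at_least n q -> depth_at_least (S n) p.
Proof.
  intros H Hn (ps & E & Hps); exists (p' :: ps); split; simpl; auto.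
  econstructor; eauto.
Qed.

Lemma depth_0 p : depth_at_least 0 p.
Proof. exists []; split; constructor. Qed.

Lemma descends_reaches ps p q : descends ps p -> In q ps -> reaches p q.
Proof.
  induction 1 as [|p p' q' ps H1 Hn Hps IH]; simpl; [tauto|].
  intros [<-|Hq]; auto.
  apply (reaches_trans H1); right; apply depends_reaches with q'; auto.
  apply t_step; auto.
Qed.

(** A predicate listed twice by [descends] would lie on a cycle through a negative dependency. So
    the listed predicates are distinct, and as sources of negative dependencies they are heads of
    rules, of which there are finitely many. *)
Lemma depth_bounded : stratified P D -> exists n, forall m p, n <= m -> ~ depth_at_least m p.
Proof.
  intros Hstrat.
  set (heads := flat_map (fun r =>
    match shead r with Some h => [satom_pred h] | None => [] end) P).
  exists (S (length heads)); intros m p Hm (ps & E & Hps).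
  enough (NoDup ps /\ incl ps heads) as [H1 H2].
  { pose proof (NoDup_incl_length H1 H2); lia. }
  clear E Hm; induction Hps as [|p p' q ps H1 Hn Hps [IH1 IH2]].
  { split; [constructor|intros x []]. }
  split.
  - constructor; auto; intros Hin.
    apply Hstrat; exists p', q; split; auto.
    destruct (descends_reaches _ Hps Hin); auto.
  - intros x [<-|Hx]; auto; destruct Hn as [r h s a Hr Eh Ha Hs].
    apply in_flat_map; exists r; rewrite Eh; simpl; auto.
Qed.

(** * Stable models of stratified programs *)

Context (theta : subst) (Htheta : is_substitution P D theta)
  (Hheads : ordinary_heads P).

Definition dep_closed (C : spred -> Prop) : Prop :=
  forall p q, C p -> depends P D p q -> C q.

(* The operator [least] is antitone in the interpretation of negation, and its value
   at depth [n] only uses negation below depth [n]. *)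
Lemma least_agree (C : spred -> Prop) e e' X Y n :
  dep_closed C ->
  (forall g, C (gatom_pred g) -> In g e -> In g e') ->
  (forall g, C (gatom_pred g) -> ~ depth_at_least n (gatom_pred g) -> Y g -> X g) ->
  forall g, C (gatom_pred g) -> ~ depth_at_least (S n) (gatom_pred g) ->
    least (with_facts theta P e) X g -> least (with_facts theta P e') Y g.
Proof.
  intros HC He HXY g Hg Hd Hl; revert Hg Hd.
  (* The conclusion, read as a set of atoms, is shown to be closed. Atoms outside [C] or of depth
     above [n] belong to it for free; in a rule for any other atom, the positive body atoms are
     again of this other kind and the negated ones have depth below [n], where [X] and [Y] are
     compared. *)
  set (J := fun g => C (gatom_pred g) -> ~ depth_at_least (S n) (gatom_pred g) ->
    least (with_facts theta P e') Y g).
  apply (Hl J); clear g Hl.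
  destruct (proj1 (closed_with_facts theta P e' Y _) (closed_least _ Y)) as [Hr' He'].
  apply closed_with_facts; split; [|intros g Hg HCg _; auto].
  intros r h sigma g Hr Eh Eg Hb HCg Hdg.
  apply (Hr' r h sigma g Hr Eh Eg).
  assert (Ep : gatom_pred g = satom_pred h).
  { rewrite (ground_atom_pred _ _ Eg); unfold satom_pred, atom_inst; simpl.
    rewrite length_map; destruct (Hheads _ Hr Eh) as [p ->]; reflexivity. }
  rewrite Ep in HCg, Hdg; unfold body_holds in *; rewrite Forall_forall in *.
  intros l' Hl'; specialize (Hb l' Hl').
  apply in_map_iff in Hl' as (l & El & Hl).
  destruct l' as [a|a|o t u]; simpl in *; auto.
  - destruct Hb as (g' & Eg' & HJ); exists g'; split; auto.
    pose proof (lit_inst_pos_depends Htheta _ _ Hr Eh Hl El) as Hdep.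
    rewrite <- (ground_atom_pred _ _ Eg') in Hdep.
    apply HJ; [eapply HC; eauto|].
    intros H; apply Hdg; eapply depth_reaches; [right|]; eauto.
  - destruct Hb as (g' & Eg' & HJ); exists g'; split; auto.
    destruct (lit_inst_neg_depends Htheta _ _ Hr Eh Hl El) as (q & Hq & Hqa).
    rewrite <- (ground_atom_pred _ _ Eg') in Hqa.
    intros HY; apply HJ; apply HXY; auto.
    + eapply HC; eauto; apply depends_reaches with q; auto; apply t_step; auto.
    + intros H; apply Hdg; eapply depth_neg; [left; reflexivity| |]; eauto.
      eapply depth_reaches; eauto.
Qed.

Context (Hstrat : stratified P D).

(** For two fixed points, [least_agree] carries agreement below depth [n] to agreement below depth
    [n + 1], and depths are bounded. [C] is everything when uniqueness is wanted, and the complement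
    of [SP] when two examples are compared. *)
Lemma stable_agree (C : spred -> Prop) e e' X Y :
  dep_closed C ->
  (forall g, C (gatom_pred g) -> In g e <-> In g e') ->
  stable (with_facts theta P e) X -> stable (with_facts theta P e') Y ->
  forall g, C (gatom_pred g) -> X g <-> Y g.
Proof.
  intros HC He HX HY.
  enough (H : forall n g, C (gatom_pred g) -> ~ depth_at_least n (gatom_pred g) ->
            X g <-> Y g).
  { destruct (depth_bounded Hstrat) as [n Hn]; intros g Hg; eauto. }
  induction n as [|n IH]; intros g Hg Hd.
  { now destruct (Hd (depth_0 _)). }
  rewrite (HX g), (HY g); split; apply (@least_agree C) with n; auto; apply IH || apply He.
Qed.

Lemma stable_unique e X Y :
  stable (with_facts theta P e) X -> stable (with_facts theta P e) Y ->
  forall g, X g <-> Y g.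
Proof.
  intros HX HY g; apply (@stable_agree (fun _ => True)) with e e; auto; [|tauto].
  intros ? ? _ _; exact I.
Qed.

(** The operator is antitone, so its iterates need not increase; but the [k]-th and the next one
    agree below depth [k]. At an index bounding all depths the iterate is a fixed point. *)
Lemma stable_exists e : exists X, stable (with_facts theta P e) X.
Proof.
  destruct (depth_bounded Hstrat) as [n Hn].
  set (T := fun k => Nat.iter k (least (with_facts theta P e)) (fun _ => False)).
  exists (T n).
  enough (H : forall k g, ~ depth_at_least k (gatom_pred g) -> T k g <-> T (S k) g).
  { intros g; exact (H n g (Hn n _ (le_n n))). }
  induction k as [|k IH]; intros g Hd.
  { now destruct (Hd (depth_0 _)). }
  simpl; split; apply (@least_agree (fun _ => True)) with k; auto;
    try (intros ? ? _ _; exact I); intros g' _ Hg'; apply IH; auto.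
Qed.

Lemma has_answer_set e X :
  stable (with_facts theta P e) X ->
  (exists M, answer_set (with_facts theta P e) M) <-> ~ violated theta P X X.
Proof.
  intros HX; split.
  - intros [M HM]; apply answer_set_with_facts in HM as [HM Hv].
    replace X with M; auto; extensionality g; apply propositional_extensionality.
    now apply stable_unique with e.
  - intros Hv; exists X; now apply answer_set_with_facts.
Qed.

End Stratified.


(** * Occurrences of the sketched variables *)

Lemma NoDup_app_disjoint (A : Type) (l l' : list A) x :
  NoDup (l ++ l') -> In x l -> ~ In x l'.
Proof.
  intros H Hl Hl'; apply in_split in Hl as (l1 & l2 & ->).
  rewrite <- app_assoc in H; apply NoDup_remove_2 in H; apply H.
  rewrite !in_app_iff; auto.
Qed.

Lemma NoDup_map_injective (A B : Type) (f : A -> B) l x y :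
  NoDup (map f l) -> In x l -> In y l -> f x = f y -> x = y.
Proof.
  induction l as [|a l IH]; simpl; [tauto|]; rewrite NoDup_cons_iff.
  intros [Ha Hl] [<-|Hx] [<-|Hy] E; auto; destruct Ha.
  - rewrite E; now apply in_map.
  - rewrite <- E; now apply in_map.
Qed.

Lemma NoDup_filter_flat_map (A B : Type) (f : B -> bool) (g : A -> list B) l a :
  NoDup (filter f (flat_map g l)) -> In a l -> NoDup (filter f (g a)).
Proof.
  induction l as [|a' l IH]; simpl; [tauto|]; rewrite filter_app.
  intros H [<-|Ha].
  - eapply NoDup_app_remove_r; eauto.
  - apply IH; auto; eapply NoDup_app_remove_l; eauto.
Qed.

Lemma NoDup_filter_flat_map_unique (A B : Type) (f : B -> bool) (g : A -> list B)
  l a b x :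
  NoDup (filter f (flat_map g l)) -> f x = true ->
  In a l -> In b l -> In x (g a) -> In x (g b) -> a = b.
Proof.
  intros H Hx; revert H; induction l as [|c l IH]; simpl; [tauto|].
  rewrite filter_app; intros H Ha Hb Hxa Hxb.
  assert (Hin : forall d, In d l -> In x (g d) -> In x (filter f (flat_map g l))).
  { intros d Hd Hxd; apply filter_In; split; auto; apply in_flat_map; eauto. }
  destruct Ha as [<-|Ha], Hb as [<-|Hb]; auto.
  - exfalso; apply (NoDup_app_disjoint _ _ x H); [apply filter_In|]; eauto.
  - exfalso; apply (NoDup_app_disjoint _ _ x H); [apply filter_In|]; eauto.
  - apply IH; auto; eapply NoDup_app_remove_l; eauto.
Qed.

(** A reified atom of a sketched negation records only the identifier [j]. This recovers which atom
    stands under that negation when such an atom is traced back to a rule. *)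
Lemma sknot_occurrence_unique P r r' j a a' :
  distinct_occurrences P -> In r P -> In r' P ->
  In (SLit (SkNot j) a) (sbody r) -> In (SLit (SkNot j) a') (sbody r') -> a = a'.
Proof.
  unfold distinct_occurrences, svars; intros Hocc Hr Hr' Ha Ha'.
  assert (Hin : forall b, In (SNot j) (lit_svars (SLit (SkNot j) b))) by (simpl; auto).
  assert (Hs : forall r a, In (SLit (SkNot j) a) (sbody r) -> In (SNot j) (rule_svars r)).
  { intros r0 a0 H0; unfold rule_svars; rewrite !in_app_iff; right; left.
    apply in_flat_map; eauto. }
  (* The identifier occurs once in the program, which fixes the rule, and once in its body, which
     fixes the literal. *)
  assert (r = r') as <- by
    (eapply NoDup_filter_flat_map_unique with (x := SNot j); eauto).
  pose proof (NoDup_filter_flat_map _ _ _ _ Hocc Hr) as H.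
  unfold rule_svars in H; rewrite !filter_app in H.
  apply NoDup_app_remove_l, NoDup_app_remove_r in H.
  assert (SLit (SkNot j) a = SLit (SkNot j) a') as [= <-]; auto.
  eapply NoDup_filter_flat_map_unique with (x := SNot j); eauto.
Qed.

(** The variable [VRes j] is named after the identifier alone, so it can hold the result of an
    operation only if a rule has a single operation with that identifier. *)
Lemma arith_occurrence_unique P r j o o' :
  distinct_occurrences P -> In r P ->
  In o (rule_arith_occs r) -> In o' (rule_arith_occs r) ->
  fst (fst o) = j -> fst (fst o') = j -> o = o'.
Proof.
  unfold distinct_occurrences, svars; intros Hocc Hr Ho Ho' E E'.
  pose proof (NoDup_filter_flat_map _ _ _ _ Hocc Hr) as H.
  unfold rule_svars in H; rewrite !filter_app in H.
  apply NoDup_app_remove_l, NoDup_app_remove_l in H.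
  assert (Hf : forall l, filter (fun s => negb (is_pred_svar s))
      (map (fun o : nat * sterm * sterm => SArith (fst (fst o))) l) =
      map (fun o => SArith (fst (fst o))) l).
  { induction l; simpl; congruence. }
  rewrite Hf in H; apply (NoDup_map_injective _ _ _ _ H Ho Ho'); congruence.
Qed.

Lemma arith_svars P r o :
  In r P -> In o (rule_arith_occs r) -> In (SArith (fst (fst o))) (svars P).
Proof.
  intros Hr Ho; apply in_flat_map; exists r; split; auto.
  unfold rule_svars; rewrite !in_app_iff; right; right.
  now apply (in_map (fun o => SArith (fst (fst o)))).
Qed.

(** Lets a value of a sketched variable be recovered from the constant in a decision argument. *)
Lemma val_const_inj s (v w : value s) : val_const s v = val_const s w -> v = w.
Proof.
  destruct s; simpl in *.
  - congruence.
  - destruct v, w; intros [=]; reflexivity.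
  - destruct v, w; intros [=]; reflexivity.
  - destruct v, w; intros [=]; reflexivity.
Qed.

Lemma cmp_eval_eq c d : cmp_eval CEq c d = true <-> c = d.
Proof.
  unfold cmp_eval, const_compare; destruct c as [a|a], d as [b|b].
  - destruct (Z.compare_spec a b); split; intros; try congruence; try lia.
    + injection H0; lia.
    + injection H0; lia.
  - split; discriminate.
  - split; discriminate.
  - destruct (String.compare a b) eqn:E; split; intros H; try congruence.
    + apply String.compare_eq_iff in E; congruence.
    + injection H as ->; pose proof (String.compare_antisym b b) as Ha; now rewrite E in Ha.
    + injection H as ->; pose proof (String.compare_antisym b b) as Ha; now rewrite E in Ha.
Qed.

(** * Closed interpretations of the rewritten program *)

Definition e_val (SP : spred -> Prop) (p : spred) (c : const) : list const :=
  if excluded_middle_informative (SP p) then [c] else [].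

Definition dec_val (sigma : tvar -> const) (k : nat) (x : sname) (n : nat)
  : list const :=
  match x with Ord _ => [] | Sk q => [sigma (VDec k (SPred q n))] end.

Definition app_name (x : sname) (n : nat) : tname :=
  match x with Ord p => TOrd p n | Sk q => TReified (SPred q n) end.

Lemma eval_list_app (V : Type) (sigma : V -> const) ts us :
  eval_list sigma (ts ++ us) =
  match eval_list sigma ts, eval_list sigma us with
  | Some cs, Some ds => Some (cs ++ ds)
  | _, _ => None
  end.
Proof.
  induction ts as [|t ts IH]; simpl.
  - now destruct (eval_list sigma us).
  - rewrite IH; destruct (eval sigma t), (eval_list sigma ts), (eval_list sigma us); auto.
Qed.

Lemma eval_e_arg SP sigma p :
  eval_list sigma (e_arg SP p) = Some (e_val SP p (sigma VE)).
Proof. unfold e_arg, e_val; now destruct (excluded_middle_informative (SP p)). Qed.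

Lemma eval_dec_arg sigma k x n :
  eval_list sigma (dec_arg k x n) = Some (dec_val sigma k x n).
Proof. now destruct x. Qed.

Lemma eval_xs sigma n :
  eval_list sigma (xs n) = Some (map (fun j => sigma (VX j)) (seq 1 n)).
Proof. unfold xs; induction (seq 1 n) as [|j l IH]; simpl; [|rewrite IH]; auto. Qed.

Lemma length_xs n : length (xs n) = n.
Proof. unfold xs; now rewrite length_map, length_seq. Qed.

Lemma ground_rw_app SP sigma k x ts cs :
  eval_list sigma ts = Some cs ->
  ground_atom sigma (rw_app SP k x ts) =
  Some (app_name x (length ts),
        e_val SP (sname_pred x (length ts)) (sigma VE) ++
        dec_val sigma k x (length ts) ++ cs).
Proof.
  intros E; unfold ground_atom, rw_app; simpl.
  now rewrite !eval_list_app, eval_e_arg, eval_dec_arg, E.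
Qed.

Lemma body_holds_cons (N V : Type) (J M : interp N) (sigma : V -> const) l b :
  body_holds J M sigma (l :: b) <-> lit_holds J M sigma l /\ body_holds J M sigma b.
Proof. apply Forall_cons_iff. Qed.

Lemma body_holds_app (N V : Type) (J M : interp N) (sigma : V -> const) b b' :
  body_holds J M sigma (b ++ b') <->
  body_holds J M sigma b /\ body_holds J M sigma b'.
Proof. apply Forall_app. Qed.

Lemma body_holds_nil (N V : Type) (J M : interp N) (sigma : V -> const) :
  body_holds J M sigma [].
Proof. constructor. Qed.

Lemma e_guard_holds SP (J M : interp tname) sigma p :
  body_holds J M sigma (e_guard SP p) <-> (SP p -> J (TExamples, [sigma VE])).
Proof.
  unfold e_guard; destruct (excluded_middle_informative (SP p)).
  - rewrite body_holds_cons; simpl; split.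
    + intros [(g & [= <-] & H) _] _; auto.
    + intros H; split; [|apply body_holds_nil].
      eexists; split; [reflexivity | auto].
  - split; [tauto | intros _; apply body_holds_nil].
Qed.

(** Substitution for the reification rules, whose variables are E, at most one decision variable,
    and X_1, X_2, ... counted from 1, hence the shift by one. *)
Definition xsubst (c d : const) (cs : list const) (x : tvar) : const :=
  match x with
  | VX (S j) => nth j cs (Num 0)
  | VE => c
  | _ => d
  end.

Lemma map_xsubst c d cs :
  map (fun j => xsubst c d cs (VX j)) (seq 1 (length cs)) = cs.
Proof.
  rewrite <- seq_shift, map_map; simpl.
  induction cs as [|a cs IH]; simpl; auto.
  f_equal; rewrite <- seq_shift, map_map; simpl; exact IH.
Qed.

(** * The rules of the rewriting as closure conditions *)

Section Rewriting.

Context (P : sprogram) (D : pdomains) (Ep En : list example).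

Local Notation SP := (in_SP P D (Ep ++ En)).
Local Notation T := (rewriting P D Ep En).

Definition ident (i : nat) : const := Num (Z.of_nat i).

Definition labelled (i : nat) (b : bool) (e : example) : Prop :=
  nth_error (map (pair true) Ep ++ map (pair false) En) i = Some (b, e).

Lemma In_combine_seq (A : Type) (l : list A) k i x :
  In (i, x) (combine (seq k (length l)) l) <->
  exists j, i = k + j /\ nth_error l j = Some x.
Proof.
  revert k; induction l as [|y l IH]; intros k; simpl.
  - split; [tauto|]; intros (j & _ & E); now destruct j.
  - rewrite IH; split.
    + intros [[= <- <-]|(j & -> & E)]; [exists 0 | exists (S j)]; split; auto; lia.
    + intros ([|j] & -> & E).
      * injection E as <-; left; f_equal; lia.
      * right; exists j; split; auto; lia.
Qed.

Lemma In_labelled_examples i b e :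
  In (i, (b, e)) (labelled_examples Ep En) <-> labelled i b e.
Proof.
  unfold labelled_examples, labelled; rewrite In_combine_seq; split.
  - intros (j & -> & E); exact E.
  - intros E; exists i; auto.
Qed.

(** One field per kind of rule, with the substitutions of the auxiliary rules evaluated away. In the
    reification fields [c] is the value of E and leaves no trace outside [SP]; [d], in the fields
    for sketched negation, is the carried decision argument and ranges over all constants, since
    these rules are not guarded by a decision. *)
Record rw_closed (M J : interp tname) : Prop := {
  rw_closed_rule r h sigma g :
    In r P -> shead r = Some h -> ground_atom sigma (rw_atom SP 0 h) = Some g ->
    body_holds J M sigma (rw_body SP r) -> J g;
  rw_closed_negsat r sigma :
    In r P -> shead r = None -> body_holds J M sigma (rw_body SP r) ->
    J (TNegative, [sigma VE]) -> J (TNegsat, [sigma VE]);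
  rw_closed_example i b e : labelled i b e -> J (TExamples, [ident i]);
  rw_closed_label i b e :
    labelled i b e -> J (if b then TPositive else TNegative, [ident i]);
  rw_closed_fact i b e p cs :
    labelled i b e -> In (p, cs) e -> J (TOrd p (length cs), ident i :: cs);
  rw_closed_dom s v :
    In s (svars P) -> In v (domain D s) -> J (TDom s, [val_const s v]);
  rw_closed_decision s c :
    In s (svars P) -> M (TDecision s, [c]) -> J (TDom s, [c]) ->
    J (TDecision s, [c]);
  rw_closed_pred q n d c cs :
    In (SPred q n) (svars P) -> In d (D q n) -> length cs = n ->
    (SP (PSk q n) -> J (TExamples, [c])) ->
    J (TOrd d n, e_val SP (POrd d n) c ++ cs) ->
    J (TReified (SPred q n), e_val SP (PSk q n) c ++ Sym d :: cs);
  rw_closed_ineq i o c d :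
    In (SIneq i) (svars P) -> cmp_eval o c d = true ->
    J (TReified (SIneq i), [cmp_const o; c; d]);
  rw_closed_arith i o a b z :
    In (SArith i) (svars P) -> aop_eval o a b = Some z ->
    J (TReified (SArith i), [aop_const o; Num a; Num b; Num z]);
  rw_closed_pos r i a c d cs :
    let n := length (saargs a) in
    let dc := match saname a with Ord _ => [] | Sk _ => [d] end in
    In r P -> In (SLit (SkNot i) a) (sbody r) -> length cs = n ->
    (SP (satom_pred a) -> J (TExamples, [c])) ->
    J (app_name (saname a) n, e_val SP (satom_pred a) c ++ dc ++ cs) ->
    J (TReified (SNot i),
       e_val SP (satom_pred a) c ++ nval_const NotAbsent :: dc ++ cs);
  rw_closed_neg r i a c d cs :
    let n := length (saargs a) in
    let dc := match saname a with Ord _ => [] | Sk _ => [d] end in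
    In r P -> In (SLit (SkNot i) a) (sbody r) -> length cs = n ->
    (SP (satom_pred a) -> J (TExamples, [c])) ->
    ~ M (app_name (saname a) n, e_val SP (satom_pred a) c ++ dc ++ cs) ->
    J (TReified (SNot i),
       e_val SP (satom_pred a) c ++ nval_const NotPresent :: dc ++ cs);
  rw_closed_term c : J (TTerm, [c])
}.

Lemma In_rewriting r :
  In r T <->
  (exists r0, In r0 P /\ In r (rw_rule SP r0)) \/
  (exists i b e, labelled i b e /\ In r (example_rules (i, (b, e)))) \/
  (exists s, In s (svars P) /\ In r (generation_rules D s)) \/
  (exists s, In s (svars P) /\ In r (reify_rules SP D s)) \/
  (exists r0 l, In r0 P /\ In l (sbody r0) /\ In r (reify_not_rules SP l)) \/
  r = term_rule \/ r = negsat_constraint.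
Proof.
  unfold rewriting; rewrite !in_app_iff, !in_flat_map; simpl.
  assert ((exists x, In x (labelled_examples Ep En) /\ In r (example_rules x)) <->
    exists i b e, labelled i b e /\ In r (example_rules (i, (b, e)))) as ->.
  { split.
    - intros ((i & b & e) & H & Hr); rewrite In_labelled_examples in H; eauto 6.
    - intros (i & b & e & H & Hr); exists (i, (b, e)).
      now rewrite In_labelled_examples. }
  assert ((exists x, In x P /\ In r (flat_map (reify_not_rules SP) (sbody x))) <->
    exists r0 l, In r0 P /\ In l (sbody r0) /\ In r (reify_not_rules SP l)) as ->.
  { split.
    - intros (x & H & Hr); apply in_flat_map in Hr as (l & Hl & Hr); eauto 6.
    - intros (r0 & l & H & Hl & Hr); exists r0; rewrite in_flat_map; eauto. }
  intuition.
Qed.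

Lemma In_rewriting_choice r a l :
  In r T -> rhead r = HChoice a l ->
  exists s, a = TDecision s /\ l = TDom s /\ In s (svars P).
Proof.
  intros Hr Eh; apply In_rewriting in Hr.
  destruct Hr as [(r0 & Hr0 & Hr)|[(i & b & e & Hi & Hr)|[(v & Hv & Hr)|
    [(v & Hv & Hr)|[(r0 & l0 & Hr0 & Hl & Hr)|[->| ->]]]]]]; try discriminate.
  - unfold rw_rule in Hr; destruct (shead r0); simpl in Hr.
    + destruct Hr as [<-|[]]; discriminate.
    + destruct Hr as [<-|[<-|[]]]; discriminate.
  - simpl in Hr; destruct Hr as [<-|[<-|Hr]]; try discriminate.
    apply in_map_iff in Hr as (? & <- & _); discriminate.
  - simpl in Hr; destruct Hr as [<-|Hr].
    + injection Eh as <- <-; eauto.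
    + apply in_map_iff in Hr as (? & <- & _); discriminate.
  - destruct v; unfold reify_rules in Hr; [| | |destruct Hr];
      apply in_map_iff in Hr as (? & <- & _); discriminate.
  - destruct l0 as [sg a0| |]; [|destruct Hr..]; destruct sg as [| |i];
      [destruct Hr..|]; simpl in Hr.
    destruct Hr as [<-|[<-|[]]]; discriminate.
Qed.

Lemma In_rewriting_bot r :
  In r T -> rhead r = HBot ->
  (exists r0, In r0 P /\ shead r0 = None /\
     r = Rule HBot (rw_body SP r0 ++ [Pos (Atom TPositive [Var VE])])) \/
  r = negsat_constraint.
Proof.
  intros Hr Eh; apply In_rewriting in Hr.
  destruct Hr as [(r0 & Hr0 & Hr)|[(i & b & e & Hi & Hr)|[(v & Hv & Hr)|
    [(v & Hv & Hr)|[(r0 & l0 & Hr0 & Hl & Hr)|[->| ->]]]]]]; try discriminate; auto.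
  - unfold rw_rule in Hr; destruct (shead r0) eqn:E0; simpl in Hr.
    + destruct Hr as [<-|[]]; discriminate.
    + destruct Hr as [<-|[<-|[]]]; [|discriminate]; eauto.
  - simpl in Hr; destruct Hr as [<-|[<-|Hr]]; try discriminate.
    apply in_map_iff in Hr as (? & <- & _); discriminate.
  - simpl in Hr; destruct Hr as [<-|Hr]; try discriminate.
    apply in_map_iff in Hr as (? & <- & _); discriminate.
  - destruct v; unfold reify_rules in Hr; [| | |destruct Hr];
      apply in_map_iff in Hr as (? & <- & _); discriminate.
  - destruct l0 as [sg a0| |]; [|destruct Hr..]; destruct sg as [| |i];
      [destruct Hr..|]; simpl in Hr.
    destruct Hr as [<-|[<-|[]]]; discriminate.
Qed.

Lemma closed_rewriting M J : closed T M J <-> rw_closed M J.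
Proof.
  split.
  - intros [H1 H2].
    assert (Hterm : forall c, J (TTerm, [c])).
    { intros c; apply (H1 term_rule (Atom TTerm [Var (VX 1)]) (fun _ => c)); auto.
      - apply In_rewriting; tauto.
      - apply body_holds_nil. }
    constructor.
    + intros r h s g Hr Eh Eg Hb.
      apply (H1 (Rule (HAtom (rw_atom SP 0 h)) (rw_body SP r)) (rw_atom SP 0 h) s);
        auto.
      apply In_rewriting; left; exists r; split; auto; unfold rw_rule; rewrite Eh.
      simpl; auto.
    + intros r s Hr Eh Hb HJ.
      apply (H1 (Rule (HAtom (Atom TNegsat [Var VE]))
        (rw_body SP r ++ [Pos (Atom TNegative [Var VE])])) (Atom TNegsat [Var VE]) s);
        auto.
      * apply In_rewriting; left; exists r; split; auto; unfold rw_rule; rewrite Eh.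
        simpl; auto.
      * simpl; rewrite body_holds_app, body_holds_cons; repeat split; auto.
        -- simpl; eexists; split; [reflexivity|auto].
        -- apply body_holds_nil.
    + intros i b e Hi.
      apply (H1 (Defs.fact tvar TExamples [ident i])
               (Atom TExamples [Cst (ident i)]) (fun _ => Num 0)); auto.
      * apply In_rewriting; right; left; exists i, b, e; simpl; auto.
      * apply body_holds_nil.
    + intros i b e Hi.
      apply (H1 (Defs.fact tvar (if b then TPositive else TNegative) [ident i])
               (Atom (if b then TPositive else TNegative) [Cst (ident i)])
               (fun _ => Num 0)); auto.
      * apply In_rewriting; right; left; exists i, b, e; simpl; auto.
      * apply body_holds_nil.
    + intros i b e p cs Hi He.
      apply (H1 (Defs.fact tvar (TOrd p (length cs)) (ident i :: cs))
               (Atom (TOrd p (length cs)) (map Cst (ident i :: cs)))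
               (fun _ => Num 0)); auto.
      * apply In_rewriting; right; left; exists i, b, e; split; auto.
        simpl; right; right.
        now apply (in_map (fun a => Defs.fact tvar (TOrd (fst a) (length (snd a)))
          (ident i :: snd a)) e (p, cs)).
      * unfold ground_atom; cbn [aargs aname]; now rewrite eval_list_cst.
      * apply body_holds_nil.
    + intros s v Hs Hv.
      apply (H1 (Defs.fact tvar (TDom s) [val_const s v])
               (Atom (TDom s) [Cst (val_const s v)]) (fun _ => Num 0)); auto.
      * apply In_rewriting; right; right; left; exists s; split; auto.
        right; now apply (in_map (fun v => Defs.fact tvar (TDom s) [val_const s v])).
      * apply body_holds_nil.
    + intros s c Hs HM HJ.
      apply (H2 (Rule (HChoice (TDecision s) (TDom s)) []) (TDecision s) (TDom s)
               (fun _ => Num 0)); auto.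
      * apply In_rewriting; right; right; left; exists s; split; auto; left; auto.
      * apply body_holds_nil.
    + intros q n d c cs Hs Hd <- Hc HJ.
      eapply (H1 _ (Atom (TReified (SPred q (length cs)))
        (e_arg SP (PSk q (length cs)) ++ Cst (Sym d) :: xs (length cs)))
        (xsubst c c cs)).
      * apply In_rewriting; do 3 right; left; exists (SPred q (length cs)); split; auto.
        simpl; eapply in_map, Hd.
      * reflexivity.
      * unfold ground_atom; simpl.
        rewrite eval_list_app, eval_e_arg; simpl; now rewrite eval_xs, map_xsubst.
      * simpl rbody; rewrite body_holds_cons, e_guard_holds; split; auto.
        simpl; rewrite (ground_rw_app _ _ _ _ _ (eval_xs _ _)), length_xs, map_xsubst.
        eauto.
    + intros i o c d Hs Ho.
      eapply (H1 _ (Atom (TReified (SIneq i)) [Cst (cmp_const o); Var (VX 1); Var (VX 2)])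
        (xsubst c c [c; d])).
      * apply In_rewriting; do 3 right; left; exists (SIneq i); split; auto.
        unfold reify_rules; apply in_map_iff; exists o; split; [reflexivity|].
        destruct o; simpl; tauto.
      * reflexivity.
      * reflexivity.
      * simpl rbody; rewrite body_holds_cons; split; [|apply body_holds_nil].
        simpl; eauto.
    + intros i o a b z Hs Ho.
      eapply (H1 _ (Atom (TReified (SArith i))
        [Cst (aop_const o); Var (VX 1); Var (VX 2); Var (VX 3)])
        (xsubst (Num a) (Num a) [Num a; Num b; Num z])).
      * apply In_rewriting; do 3 right; left; exists (SArith i); split; auto.
        unfold reify_rules; apply in_map_iff; exists o; split; [reflexivity|].
        destruct o; simpl; tauto.
      * reflexivity.
      * reflexivity.
      * simpl rbody; rewrite body_holds_cons; split; [|apply body_holds_nil].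
        exists (Num z), (Num z); cbn -[cmp_eval]; rewrite Ho; repeat split.
        now apply cmp_eval_eq.
    + intros r i a c d cs n dc Hr Ha Hn Hc HJ; subst n.
      eapply (H1 _ (Atom (TReified (SNot i)) (e_arg SP (satom_pred a) ++
        Cst (nval_const NotAbsent) ::
        dec_arg 0 (saname a) (length (saargs a)) ++ xs (length (saargs a))))
        (xsubst c d cs)).
      * apply In_rewriting; do 4 right; left; exists r, (SLit (SkNot i) a).
        split; auto; split; auto; left; reflexivity.
      * reflexivity.
      * unfold ground_atom; simpl; rewrite eval_list_app, eval_e_arg; simpl.
        rewrite eval_list_app, eval_dec_arg, eval_xs, <- Hn, map_xsubst; simpl.
        subst dc; now destruct (saname a).
      * simpl rbody; rewrite body_holds_cons, e_guard_holds; split; auto.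
        simpl; rewrite (ground_rw_app _ _ _ _ _ (eval_xs _ _)), length_xs, <- Hn,
          map_xsubst.
        eexists; split; [reflexivity|]; rewrite Hn; subst dc.
        unfold satom_pred in *; destruct (saname a); exact HJ.
    + intros r i a c d cs n dc Hr Ha Hn Hc HJ; subst n.
      eapply (H1 _ (Atom (TReified (SNot i)) (e_arg SP (satom_pred a) ++
        Cst (nval_const NotPresent) ::
        dec_arg 0 (saname a) (length (saargs a)) ++ xs (length (saargs a))))
        (xsubst c d cs)).
      * apply In_rewriting; do 4 right; left; exists r, (SLit (SkNot i) a).
        split; auto; split; auto; right; left; reflexivity.
      * reflexivity.
      * unfold ground_atom; simpl; rewrite eval_list_app, eval_e_arg; simpl.
        rewrite eval_list_app, eval_dec_arg, eval_xs, <- Hn, map_xsubst; simpl.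
        subst dc; now destruct (saname a).
      * simpl rbody; rewrite body_holds_cons, body_holds_app, e_guard_holds.
        split; [|split]; auto.
        -- simpl; rewrite (ground_rw_app _ _ _ _ _ (eval_xs _ _)), length_xs, <- Hn,
             map_xsubst.
           eexists; split; [reflexivity|]; rewrite Hn; subst dc.
           unfold satom_pred in *; destruct (saname a); exact HJ.
        (* The term guards are applied to variables only, so they are defined under any substitution
           and hold by [Hterm]. *)
        -- apply Forall_forall; intros l Hl.
           apply in_map_iff in Hl as (t & <- & Ht).
           assert (exists x, t = Var x) as (x & ->).
           { apply in_app_or in Ht as [Ht|Ht].
             - destruct (saname a); simpl in Ht; [tauto|].
               destruct Ht as [<-|[]]; eauto.
             - apply in_map_iff in Ht as (j & <- & _); eauto. }
           simpl; eexists; split; [reflexivity | apply Hterm].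
    + exact Hterm.
  - intros H; split.
    + intros r h s g Hr Eh Eg Hb; apply In_rewriting in Hr.
      destruct Hr as [(r0 & Hr0 & Hr)|[(i & b & e & Hi & Hr)|[(v & Hv & Hr)|
        [(v & Hv & Hr)|[(r0 & l & Hr0 & Hl & Hr)|[->| ->]]]]]].
      * unfold rw_rule in Hr; destruct (shead r0) as [h0|] eqn:E0; simpl in Hr.
        -- destruct Hr as [<-|[]]; injection Eh as <-.
           eapply (rw_closed_rule H); eauto.
        -- destruct Hr as [<-|[<-|[]]]; [discriminate|]; injection Eh as <-.
           simpl in Hb; rewrite body_holds_app, body_holds_cons in Hb.
           destruct Hb as (Hb & (g' & [= <-] & Hg) & _); injection Eg as <-.
           eapply (rw_closed_negsat H); eauto.
      * simpl in Hr; destruct Hr as [<-|[<-|Hr]].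
        -- injection Eh as <-; injection Eg as <-; exact (rw_closed_example H Hi).
        -- injection Eh as <-; injection Eg as <-; exact (rw_closed_label H Hi).
        -- apply in_map_iff in Hr as ([p cs] & <- & He); injection Eh as <-.
           change (ground_atom s (Atom (TOrd p (length cs)) (map Cst (ident i :: cs)))
             = Some g) in Eg.
           unfold ground_atom in Eg; cbn [aargs aname] in Eg.
           rewrite eval_list_cst in Eg; injection Eg as <-.
           eapply (rw_closed_fact H); eauto.
      * simpl in Hr; destruct Hr as [<-|Hr]; [discriminate|].
        apply in_map_iff in Hr as (w & <- & Hw); injection Eh as <-.
        injection Eg as <-; eapply (rw_closed_dom H); eauto.
      * destruct v as [q n|i|i|i]; unfold reify_rules in Hr; [| | |destruct Hr].
        -- apply in_map_iff in Hr as (d & <- & Hd); injection Eh as <-.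
           unfold ground_atom in Eg; simpl in Eg.
           rewrite eval_list_app, eval_e_arg in Eg; simpl in Eg.
           rewrite eval_xs in Eg; injection Eg as <-.
           simpl rbody in Hb; rewrite body_holds_cons, e_guard_holds in Hb.
           destruct Hb as ((g & Eg & Hg) & Hc).
           rewrite (ground_rw_app _ _ _ _ _ (eval_xs _ _)), length_xs in Eg.
           injection Eg as <-.
           apply (rw_closed_pred H); auto; now rewrite length_map, length_seq.
        -- apply in_map_iff in Hr as (d & <- & Hd); injection Eh as <-.
           injection Eg as <-; simpl rbody in Hb; rewrite body_holds_cons in Hb.
           destruct Hb as [(c & c' & [= <-] & [= <-] & E) _].
           now apply (rw_closed_ineq H).
        -- apply in_map_iff in Hr as (d & <- & Hd); injection Eh as <-.
           injection Eg as <-; simpl rbody in Hb; rewrite body_holds_cons in Hb.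
           destruct Hb as [(c & c' & Ec & Ec' & E) _].
           apply cmp_eval_eq in E as <-; injection Ec as <-.
           cbn in Ec'; destruct (s (VX 1)) as [a|], (s (VX 2)) as [b|]; try discriminate.
           destruct (aop_eval d a b) as [z|] eqn:Ez; [|discriminate].
           injection Ec' as <-; now apply (rw_closed_arith H).
      * destruct l as [sg a| |]; [|destruct Hr..]; destruct sg as [| |i];
          [destruct Hr..|]; simpl in Hr.
        (* An ordinary predicate has no decision argument; [Num 0] merely fills the place of [d], so
           that both kinds of predicate instantiate [rw_closed_pos] and [rw_closed_neg] in the same
           way. *)
        assert (Edv : dec_val s 0 (saname a) (length (saargs a)) =
          match saname a with
          | Ord _ => []
          | Sk _ => [match saname a with
                     | Ord _ => Num 0
                     | Sk q => s (VDec 0 (SPred q (length (saargs a))))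
                     end]
          end) by now destruct (saname a).
        assert (Hlen : length (map (fun j => s (VX j)) (seq 1 (length (saargs a)))) =
          length (saargs a)) by now rewrite length_map, length_seq.
        destruct Hr as [<-|[<-|[]]]; injection Eh as <-;
          unfold ground_atom in Eg; simpl in Eg;
          rewrite eval_list_app, eval_e_arg in Eg; simpl in Eg;
          rewrite eval_list_app, eval_dec_arg, eval_xs, Edv in Eg; injection Eg as <-;
          simpl rbody in Hb; rewrite ?body_holds_cons, ?body_holds_app, e_guard_holds in Hb.
        -- destruct Hb as ((g & Eg & Hg) & Hc).
           rewrite (ground_rw_app _ _ _ _ _ (eval_xs _ _)), length_xs, Edv in Eg.
           injection Eg as <-.
           exact (@rw_closed_pos M J H r0 i a _ _ _ Hr0 Hl Hlen Hc Hg).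
        -- destruct Hb as ((g & Eg & Hg) & _ & Hc).
           rewrite (ground_rw_app _ _ _ _ _ (eval_xs _ _)), length_xs, Edv in Eg.
           injection Eg as <-.
           exact (@rw_closed_neg M J H r0 i a _ _ _ Hr0 Hl Hlen Hc Hg).
      * injection Eh as <-; injection Eg as <-; apply (rw_closed_term H).
      * discriminate.
    + intros r a l s c Hr Eh Hb HM HJ.
      destruct (In_rewriting_choice _ Hr Eh) as (v & -> & -> & Hv).
      now apply (rw_closed_decision H).
Qed.

Lemma choice_bounds_rewriting M :
  choice_bounds T M <->
  forall s, In s (svars P) -> exists! c, M (TDom s, [c]) /\ M (TDecision s, [c]).
Proof.
  rewrite choice_bounds_holds; split.
  - intros H s Hs.
    apply (H (Rule (HChoice (TDecision s) (TDom s)) []) _ _ (fun _ => Num 0)); auto.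
    + apply In_rewriting; right; right; left; exists s; split; auto; left; auto.
    + apply body_holds_nil.
  - intros H r a l s Hr Eh _.
    destruct (In_rewriting_choice _ Hr Eh) as (v & -> & -> & Hv); auto.
Qed.

Lemma constraints_rewriting M :
  constraints_hold T M <->
  (forall r sigma, In r P -> shead r = None ->
     body_holds M M sigma (rw_body SP r) -> ~ M (TPositive, [sigma VE])) /\
  (forall c, M (TNegative, [c]) -> M (TNegsat, [c])).
Proof.
  split.
  - intros H; split.
    + intros r s Hr Eh Hb HM.
      apply (H (Rule HBot (rw_body SP r ++ [Pos (Atom TPositive [Var VE])])) s); auto.
      * apply In_rewriting; left; exists r; split; auto.
        unfold rw_rule; rewrite Eh; simpl; auto.
      * simpl; rewrite body_holds_app, body_holds_cons; repeat split; auto.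
        -- simpl; eexists; split; [reflexivity|auto].
        -- apply body_holds_nil.
    + intros c HM; apply NNPP; intros Hn.
      apply (H negsat_constraint (fun _ => c)); auto.
      * apply In_rewriting; tauto.
      * simpl; rewrite !body_holds_cons; repeat split.
        -- simpl; eexists; split; [reflexivity|auto].
        -- simpl; eexists; split; [reflexivity|auto].
        -- apply body_holds_nil.
  - intros [H1 H2] r s Hr Eh Hb.
    destruct (In_rewriting_bot _ Hr Eh) as [(r0 & Hr0 & E0 & ->)| ->];
      simpl in Hb.
    + rewrite body_holds_app, body_holds_cons in Hb.
      destruct Hb as (Hb & (g & [= <-] & Hg) & _); exact (H1 r0 s Hr0 E0 Hb Hg).
    + rewrite !body_holds_cons in Hb.
      destruct Hb as ((g & [= <-] & Hg) & (g' & [= <-] & Hg') & _); auto.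
Qed.

End Rewriting.


(** * Translating rule bodies *)

Lemma ident_inj i j : ident i = ident j -> i = j.
Proof. intros [= H]; now apply Nat2Z.inj. Qed.

(** The identifier can be read back from the arguments only for a predicate in [SP]; otherwise equal
    arguments may come from different examples. *)
Lemma e_val_app_inj SP p c c' cs cs' :
  e_val SP p c ++ cs = e_val SP p c' ++ cs' ->
  cs = cs' /\ e_val SP p c = e_val SP p c' /\ (SP p -> c = c').
Proof.
  unfold e_val; destruct (excluded_middle_informative (SP p)); simpl.
  - intros [= -> ->]; auto.
  - intros ->; tauto.
Qed.

Lemma e_val_not SP p c : ~ SP p -> e_val SP p c = [].
Proof. unfold e_val; destruct (excluded_middle_informative (SP p)); tauto. Qed.

(** * Evaluation of terms with sketched arithmetic *)

Lemma eval_list_map_ext (A V W : Type) (sigma : V -> const) (tau : W -> const)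
  (f : A -> term V) (g : A -> term W) l :
  (forall a, In a l -> eval sigma (f a) = eval tau (g a)) ->
  eval_list sigma (map f l) = eval_list tau (map g l).
Proof.
  induction l as [|a l IH]; simpl; intros H; auto.
  now rewrite H, IH by auto.
Qed.

Lemma eval_list_defined (V : Type) (sigma : V -> const) ts cs t :
  eval_list sigma ts = Some cs -> In t ts -> exists c, eval sigma t = Some c.
Proof.
  revert cs; induction ts as [|u ts IH]; simpl; intros cs E; [tauto|].
  destruct (eval sigma u) eqn:Eu; [|discriminate].
  destruct (eval_list sigma ts); [|discriminate].
  intros [<-|Ht]; eauto.
Qed.

Lemma arith_occs_incl t j u v :
  In (j, u, v) (arith_occs t) ->
  incl (arith_occs u) (arith_occs t) /\ incl (arith_occs v) (arith_occs t).
Proof.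
  induction t as [x|c|o t1 IH1 t2 IH2|i t1 IH1 t2 IH2]; simpl; try tauto.
  - rewrite in_app_iff; intros [H|H]; [destruct (IH1 H)|destruct (IH2 H)];
      split; auto using incl_appl, incl_appr.
  - rewrite in_app_iff; intros [[= -> -> ->]|[H|H]];
      [|destruct (IH1 H)|destruct (IH2 H)];
      split; apply incl_tl; auto using incl_appl, incl_appr, incl_refl.
Qed.

Lemma rule_arith_occs_incl r j u v :
  In (j, u, v) (rule_arith_occs r) ->
  incl (arith_occs u) (rule_arith_occs r) /\ incl (arith_occs v) (rule_arith_occs r).
Proof.
  unfold rule_arith_occs; intros H; apply in_flat_map in H as (t & Ht & H).
  apply arith_occs_incl in H as [H1 H2].
  split; intros o Ho; apply in_flat_map; eauto.
Qed.

Lemma rule_arith_occs_head r h t :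
  shead r = Some h -> In t (saargs h) -> incl (arith_occs t) (rule_arith_occs r).
Proof.
  intros Eh Ht o Ho; unfold rule_arith_occs; rewrite Eh.
  apply in_flat_map; exists t; rewrite in_app_iff; auto.
Qed.

Lemma rule_arith_occs_body r l t :
  In l (sbody r) -> In t (lit_terms l) -> incl (arith_occs t) (rule_arith_occs r).
Proof.
  intros Hl Ht o Ho; unfold rule_arith_occs.
  apply in_flat_map; exists t; rewrite in_app_iff, in_flat_map; eauto.
Qed.

(** Serves the passage from the rewriting to the instance. The reified literals give each result
    variable an equation over rewritten operands, which may contain further result variables, so
    values are identified from the innermost operation outwards. *)
Lemma eval_rw_term_of_results (theta : subst) (sigma : tvar -> const) t :
  (forall j u v, In (j, u, v) (arith_occs t) ->
     eval sigma (Bin (theta (SArith j)) (rw_term u) (rw_term v)) =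
     Some (sigma (VRes j))) ->
  eval sigma (rw_term t) = eval (fun x => sigma (VOrig x)) (term_inst theta t).
Proof.
  induction t as [x|c|o t1 IH1 t2 IH2|i t1 IH1 t2 IH2]; simpl arith_occs; intros H.
  - reflexivity.
  - reflexivity.
  - simpl; rewrite IH1, IH2; auto; intros; apply H; rewrite in_app_iff; auto.
  - assert (H1 : eval sigma (rw_term t1) =
      eval (fun x => sigma (VOrig x)) (term_inst theta t1)).
    { apply IH1; intros; apply H; simpl; rewrite in_app_iff; auto. }
    assert (H2 : eval sigma (rw_term t2) =
      eval (fun x => sigma (VOrig x)) (term_inst theta t2)).
    { apply IH2; intros; apply H; simpl; rewrite in_app_iff; auto. }
    specialize (H i t1 t2 (or_introl eq_refl)); cbn in H |- *.
    rewrite <- H1, <- H2; auto.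
Qed.

(** Serves the opposite passage, where the result variables have been set to the values of the
    instance, so that a sketched operation is settled without looking at its operands. *)
Lemma eval_rw_term_of_values (theta : subst) (sigma : tvar -> const) t :
  (forall j u v, In (j, u, v) (arith_occs t) ->
     eval (fun x => sigma (VOrig x)) (term_inst theta (SkBin j u v)) =
     Some (sigma (VRes j))) ->
  eval sigma (rw_term t) = eval (fun x => sigma (VOrig x)) (term_inst theta t).
Proof.
  induction t as [x|c|o t1 IH1 t2 IH2|i t1 IH1 t2 IH2]; simpl arith_occs; intros H.
  - reflexivity.
  - reflexivity.
  - simpl; rewrite IH1, IH2; auto; intros; apply H; rewrite in_app_iff; auto.
  - now rewrite (H i t1 t2 (or_introl eq_refl)).
Qed.

Lemma eval_bin_defined (V : Type) (sigma : V -> const) o t u c :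
  eval sigma (Bin o t u) = Some c ->
  exists a b z, eval sigma t = Some (Num a) /\ eval sigma u = Some (Num b) /\
    aop_eval o a b = Some z /\ c = Num z.
Proof.
  simpl; destruct (eval sigma t) as [[a|]|]; try discriminate.
  destruct (eval sigma u) as [[b|]|]; try discriminate.
  destruct (aop_eval o a b) as [z|] eqn:E; try discriminate.
  intros [= <-]; eauto 7.
Qed.

(** Evaluation is strict, so a defined term supplies a value for the result variable of each
    sketched operation inside it. *)
Lemma arith_occs_defined (theta : subst) sigma t j u v c :
  eval sigma (term_inst theta t) = Some c -> In (j, u, v) (arith_occs t) ->
  exists d, eval sigma (term_inst theta (SkBin j u v)) = Some d.
Proof.
  revert c; induction t as [x|c|o t1 IH1 t2 IH2|i t1 IH1 t2 IH2]; simpl arith_occs;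
    intros c' E H.
  - destruct H.
  - destruct H.
  - apply eval_bin_defined in E as (a & b & z & E1 & E2 & _).
    apply in_app_iff in H as [H|H]; eauto.
  - destruct H as [[= -> -> ->]|H]; eauto.
    apply eval_bin_defined in E as (a & b & z & E1 & E2 & _).
    apply in_app_iff in H as [H|H]; eauto.
Qed.

(** * Gluing a family of interpretations *)

Section Translation.

Context (P : sprogram) (D : pdomains) (Ep En : list example) (theta : subst).
Context (Hocc : distinct_occurrences P) (Hheads : ordinary_heads P)
  (Htheta : is_substitution P D theta).

Local Notation SP := (in_SP P D (Ep ++ En)).
Local Notation labelled := (labelled Ep En).
Local Notation rw_closed := (rw_closed P D Ep En).

Definition valid (i : nat) : Prop := exists b e, labelled i b e.

Lemma SP_depends p q : depends P D p q -> SP q -> SP p.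
Proof.
  intros H (q' & Hq & Hqq); exists q'; split; auto; right.
  destruct Hqq as [->|Hqq]; auto; eapply t_trans; eauto.
Qed.

Lemma SP_domain q n d :
  In (SPred q n) (svars P) -> In d (D q n) -> SP (POrd d n) -> SP (PSk q n).
Proof. intros Hs Hd; apply SP_depends; apply t_step; left; now constructor. Qed.

(* Outside SP the identifier [i] leaves no trace in the arguments, so membership only
   means that some [B i] contains the atom; see [coherent]. *)
Definition lift_app (B : nat -> interp string) (x : sname) (n : nat)
  (args : list const) : Prop :=
  exists i cs, valid i /\ length cs = n /\
  match x with
  | Ord p => args = e_val SP (POrd p n) (ident i) ++ cs /\ B i (p, cs)
  | Sk q => In (SPred q n) (svars P) /\ exists d, In d (D q n) /\
      args = e_val SP (PSk q n) (ident i) ++ Sym d :: cs /\ B i (d, cs)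
  end.

(* Negation is read off [A], everything else off [B]. *)
Definition lift (A B : nat -> interp string) : interp tname := fun g =>
  match fst g with
  | TOrd p n => lift_app B (Ord p) n (snd g)
  | TExamples => exists i, valid i /\ snd g = [ident i]
  | TPositive => exists i e, labelled i true e /\ snd g = [ident i]
  | TNegative => exists i e, labelled i false e /\ snd g = [ident i]
  | TNegsat => exists i e, labelled i false e /\ snd g = [ident i] /\
      violated theta P (B i) (A i)
  | TDecision s => In s (svars P) /\ snd g = [val_const s (theta s)]
  | TDom s => In s (svars P) /\ exists v, In v (domain D s) /\ snd g = [val_const s v]
  | TReified (SPred q n) => lift_app B (Sk q) n (snd g)
  | TReified (SIneq j) => In (SIneq j) (svars P) /\ exists o c d,
      snd g = [cmp_const o; c; d] /\ cmp_eval o c d = true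
  | TReified (SArith j) => In (SArith j) (svars P) /\ exists o a b z,
      snd g = [aop_const o; Num a; Num b; Num z] /\ aop_eval o a b = Some z
  | TReified (SNot j) => exists r a c d cs,
      let n := length (saargs a) in
      let p := satom_pred a in
      let dc := match saname a with Ord _ => [] | Sk _ => [d] end in
      In r P /\ In (SLit (SkNot j) a) (sbody r) /\ length cs = n /\
      (SP p -> exists i, valid i /\ c = ident i) /\
      (snd g = e_val SP p c ++ nval_const NotAbsent :: dc ++ cs /\
         lift_app B (saname a) n (e_val SP p c ++ dc ++ cs) \/
       snd g = e_val SP p c ++ nval_const NotPresent :: dc ++ cs /\
         ~ lift_app A (saname a) n (e_val SP p c ++ dc ++ cs))
  | TTerm => exists c, snd g = [c]
  end.

Definition coherent (B : nat -> interp string) : Prop :=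
  forall i j g, valid i -> valid j -> ~ SP (gatom_pred g) -> B i g -> B j g.

Lemma lift_app_name A B x n args :
  lift A B (app_name x n, args) <-> lift_app B x n args.
Proof. destruct x; reflexivity. Qed.

(** The index witnessing membership need not be [i]. In [SP] the identifier among the arguments
    forces it to be; outside [SP] coherence transports the atom to [i]. *)
Lemma lift_app_ord B i p n cs :
  coherent B -> valid i -> length cs = n ->
  lift_app B (Ord p) n (e_val SP (POrd p n) (ident i) ++ cs) <-> B i (p, cs).
Proof.
  intros HB Hi Hn; split.
  - intros (j & cs' & Hj & Hn' & E & H).
    apply e_val_app_inj in E as (<- & _ & E).
    destruct (classic (SP (POrd p n))) as [Hp|Hp].
    + now rewrite (ident_inj (E Hp)).
    + apply (HB j i); auto; unfold gatom_pred; simpl; now rewrite Hn.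
  - intros H; exists i, cs; auto.
Qed.

(** As for ordinary predicates, except that coherence is applied to the domain predicate [d], which
    lies outside [SP] whenever the sketched predicate does. *)
Lemma lift_app_sk B i q n d cs :
  coherent B -> valid i -> length cs = n -> In (SPred q n) (svars P) ->
  lift_app B (Sk q) n (e_val SP (PSk q n) (ident i) ++ Sym d :: cs) <->
  In d (D q n) /\ B i (d, cs).
Proof.
  intros HB Hi Hn Hs; split.
  - intros (j & cs' & Hj & Hn' & _ & d' & Hd & E & H).
    apply e_val_app_inj in E as ([= <- <-] & _ & E); split; auto.
    destruct (classic (SP (PSk q n))) as [Hp|Hp].
    + now rewrite (ident_inj (E Hp)).
    + apply (HB j i); auto; unfold gatom_pred; simpl; rewrite Hn.
      intros Hq; apply Hp; eapply SP_domain; eauto.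
  - intros [Hd H]; exists i, cs; eauto 8.
Qed.

Lemma lift_app_inst B i k r l sg a sigma cs :
  coherent B -> valid i -> In r P -> In l (sbody r) -> l = SLit sg a ->
  (forall s, In s (lit_svars l) -> sigma (VDec k s) = val_const s (theta s)) ->
  length cs = length (saargs a) ->
  lift_app B (saname a) (length (saargs a))
    (e_val SP (satom_pred a) (ident i) ++
     dec_val sigma k (saname a) (length (saargs a)) ++ cs) <->
  B i (aname (atom_inst theta a), cs).
Proof.
  intros HB Hi Hr Hl -> Hdec Hn; unfold satom_pred, atom_inst; simpl aname.
  destruct (saname a) as [p|q] eqn:Ea; simpl.
  - now apply lift_app_ord.
  - assert (Hq : In (SPred q (length (saargs a))) (lit_svars (SLit sg a))).
    { unfold lit_svars, atom_svars; rewrite Ea; destruct sg; simpl; auto. }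
    assert (Hs : In (SPred q (length (saargs a))) (svars P)).
    { eapply lit_svars_svars; eauto. }
    rewrite (Hdec _ Hq); simpl; rewrite lift_app_sk; auto.
    pose proof (Htheta _ Hs) as Hd; simpl in Hd; tauto.
Qed.

Lemma ground_rw_app_inv SP' sigma k x ts g :
  ground_atom sigma (rw_app SP' k x ts) = Some g ->
  exists cs, eval_list sigma ts = Some cs /\ length cs = length ts /\
    g = (app_name x (length ts),
         e_val SP' (sname_pred x (length ts)) (sigma VE) ++
         dec_val sigma k x (length ts) ++ cs).
Proof.
  intros E; destruct (eval_list sigma ts) as [cs|] eqn:Ec.
  - rewrite (ground_rw_app _ _ _ _ _ Ec) in E; injection E as <-.
    exists cs; repeat split; eapply eval_list_length; eauto.
  - unfold ground_atom, rw_app in E; simpl in E.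
    now rewrite !eval_list_app, eval_e_arg, eval_dec_arg, Ec in E.
Qed.

Lemma In_places l (ls : list slit) :
  In l ls -> exists k, In (k, l) (combine (seq 1 (length ls)) ls).
Proof.
  intros H; apply In_nth_error in H as [j H].
  exists (1 + j); apply In_combine_seq; eauto.
Qed.

Lemma In_places_inv k l (ls : list slit) :
  In (k, l) (combine (seq 1 (length ls)) ls) -> In l ls.
Proof. apply in_combine_r. Qed.

(** Only the inclusion of the glued [A] in [M] is asked: what is absent from [M] is then absent from
    [A i], which is all that negated literals need. This leaves room for an answer set [M] that is
    not known to be glued from anything. *)
Lemma lit_holds_down A B M i k r l sigma :
  coherent A -> coherent B -> valid i -> sigma VE = ident i ->
  (forall x n args, lift_app A x n args -> M (app_name x n, args)) ->
  In r P -> In l (sbody r) ->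
  (forall s, In s (lit_svars l) -> sigma (VDec k s) = val_const s (theta s)) ->
  (forall t, In t (lit_terms l) ->
     eval sigma (rw_term t) = eval (fun x => sigma (VOrig x)) (term_inst theta t)) ->
  lit_holds (lift A B) M sigma (rw_lit SP k l) ->
  lit_holds (B i) (A i) (fun x => sigma (VOrig x)) (lit_inst theta l).
Proof.
  intros HA HB Hi HE HM Hr Hl Hdec Ht H.
  assert (Hargs : forall sg a, l = SLit sg a ->
    eval_list (fun x => sigma (VOrig x)) (map (term_inst theta) (saargs a)) =
    eval_list sigma (map rw_term (saargs a))).
  { intros sg a ->; symmetry; apply eval_list_map_ext; exact Ht. }
  assert (Hground : forall sg a cs, l = SLit sg a ->
    eval_list sigma (map rw_term (saargs a)) = Some cs ->
    ground_atom (fun x => sigma (VOrig x)) (atom_inst theta a) =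
    Some (aname (atom_inst theta a), cs)).
  { intros sg a cs E Ec; unfold ground_atom, atom_inst; simpl.
    now rewrite (Hargs sg a E), Ec. }
  destruct l as [sg a|o t u|j t u].
  - assert (Happ : forall g, ground_atom sigma (rw_atom SP k a) = Some g ->
      exists cs, eval_list sigma (map rw_term (saargs a)) = Some cs /\
      length cs = length (saargs a) /\
      g = (app_name (saname a) (length (saargs a)),
           e_val SP (satom_pred a) (ident i) ++
           dec_val sigma k (saname a) (length (saargs a)) ++ cs)).
    { intros g Eg; apply ground_rw_app_inv in Eg as (cs & Ec & Hn & ->).
      rewrite length_map, HE in *; eauto. }
    destruct sg as [| |j]; simpl in H |- *.
    + destruct H as (g & Eg & Hg); apply Happ in Eg as (cs & Ec & Hn & ->).
      rewrite lift_app_name, lift_app_inst in Hg; eauto.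
    + destruct H as (g & Eg & Hg); apply Happ in Eg as (cs & Ec & Hn & ->).
      eexists; split; [eauto|]; intros HAi; apply Hg, HM.
      rewrite lift_app_inst; eauto.
    + destruct H as (g & Eg & Hg); unfold ground_atom in Eg; simpl in Eg.
      rewrite eval_list_app, eval_e_arg in Eg; simpl in Eg.
      rewrite eval_list_app, eval_dec_arg in Eg.
      destruct (eval_list sigma (map rw_term (saargs a))) as [cs|] eqn:Ec;
        [|discriminate].
      injection Eg as <-; rewrite HE, (Hdec (SNot j)) in Hg by (simpl; auto).
      assert (Hn : length cs = length (saargs a)).
      { rewrite (eval_list_length _ _ Ec); apply length_map. }
      destruct Hg as (r' & a' & c & d & cs' & Hr' & Ha' & Hn' & Hc & Hg).
      assert (a' = a) as -> by
        exact (@sknot_occurrence_unique P r' r j a' a Hocc Hr' Hr Ha' Hl).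
      (* Behind the common E argument, the head of each list is the value of the sketched negation
         and the tail holds the arguments of the atom below it. The default of [hd] is never
         reached. *)
      assert (Hdc : forall v,
        e_val SP (satom_pred a) (ident i) ++ val_const (SNot j) (theta (SNot j)) ::
          dec_val sigma k (saname a) (length (saargs a)) ++ cs =
        e_val SP (satom_pred a) c ++ nval_const v ::
          match saname a with Ord _ => [] | Sk _ => [d] end ++ cs' ->
        theta (SNot j) = v /\
        e_val SP (satom_pred a) c ++
          match saname a with Ord _ => [] | Sk _ => [d] end ++ cs' =
        e_val SP (satom_pred a) (ident i) ++
          dec_val sigma k (saname a) (length (saargs a)) ++ cs).
      { intros v E; apply e_val_app_inj in E as (E & <- & _).
        pose proof (f_equal (@tl const) E) as Et; simpl in Et; rewrite Et; split; auto.
        exact (val_const_inj (SNot j) _ _ (f_equal (hd (Num 0)) E)). }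
      destruct Hg as [[E Hg]|[E Hg]]; apply Hdc in E as [-> E]; rewrite E in Hg;
        simpl; eexists; (split; [eauto|]).
      * rewrite lift_app_inst in Hg; eauto.
      * intros HAi; apply Hg; rewrite lift_app_inst; eauto.
  - simpl in H, Ht |- *; rewrite <- !Ht by auto; exact H.
  - simpl in H, Ht |- *; rewrite <- !Ht by auto.
    destruct H as (g & Eg & Hg); unfold ground_atom in Eg; simpl in Eg.
    destruct (eval sigma (rw_term t)) as [c|]; [|discriminate].
    destruct (eval sigma (rw_term u)) as [d|]; [|discriminate].
    injection Eg as <-; destruct Hg as (_ & o & c' & d' & E & Ho); simpl in E.
    rewrite (Hdec (SIneq j)) in E by (simpl; auto).
    pose proof (val_const_inj (SIneq j) _ _ (f_equal (hd (Num 0)) E)) as Eo.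
    pose proof (f_equal (@tl const) E) as Et; injection Et as <- <-.
    rewrite Eo; eauto.
Qed.

(** The guard [examples(E)] supplies [i], the decision literals force the values of [theta], and the
    reified arithmetic literals give the equations of the result variables. Operations in the head
    also have their literals in the body, so head terms are covered as well. *)
Lemma body_down A B M r sigma :
  coherent A -> coherent B ->
  (forall x n args, lift_app A x n args -> M (app_name x n, args)) ->
  In r P -> body_holds (lift A B) M sigma (rw_body SP r) ->
  exists i, valid i /\ sigma VE = ident i /\
    (forall t, incl (arith_occs t) (rule_arith_occs r) ->
       eval sigma (rw_term t) =
       eval (fun x => sigma (VOrig x)) (term_inst theta t)) /\
    body_holds (B i) (A i) (fun x => sigma (VOrig x))
      (map (lit_inst theta) (sbody r)).
Proof.
  intros HA HB HM Hr Hb; unfold rw_body in Hb; rewrite !body_holds_app in Hb.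
  destruct Hb as (Hl & _ & Hd & Ha & He).
  apply body_holds_cons in He as [(g & [= <-] & i & Hi & [= HE]) _].
  assert (Hdecision : forall k s, lit_holds (lift A B) M sigma (decision_lit k s) ->
    sigma (VDec k s) = val_const s (theta s)).
  { intros k s (g & [= <-] & _ & [= H]); exact H. }
  assert (Hterm : forall t, incl (arith_occs t) (rule_arith_occs r) ->
    eval sigma (rw_term t) = eval (fun x => sigma (VOrig x)) (term_inst theta t)).
  { intros t Ht; apply eval_rw_term_of_results; intros j u v Ho.
    assert (H : body_holds (lift A B) M sigma (arith_lits (j, u, v))).
    { apply Forall_forall; intros l Hlin; unfold body_holds in Ha.
      rewrite Forall_forall in Ha; apply Ha, in_flat_map; eauto. }
    simpl in H; rewrite !body_holds_cons in H.
    destruct H as ((g & Eg & Hg) & H & _); apply Hdecision in H.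
    unfold ground_atom in Eg; simpl in Eg; rewrite H in Eg.
    destruct (eval sigma (rw_term u)) as [cu|] eqn:Eu; [|discriminate].
    destruct (eval sigma (rw_term v)) as [cv|] eqn:Ev; [|discriminate].
    injection Eg as <-; destruct Hg as (_ & o & a & b & z & E & Eo); simpl in E.
    pose proof (val_const_inj (SArith j) _ _ (f_equal (hd (Num 0)) E)) as Et.
    pose proof (f_equal (@tl const) E) as E'; injection E' as -> -> Ez.
    simpl eval; rewrite Eu, Ev, Et, Eo, Ez; reflexivity. }
  exists i; repeat split; auto.
  apply Forall_forall; intros l' Hl'; apply in_map_iff in Hl' as (l & <- & Hlr).
  destruct (In_places _ _ Hlr) as [k Hk].
  unfold body_holds in Hl, Hd; rewrite Forall_forall in Hl, Hd.
  apply (@lit_holds_down A B M i k r l sigma); auto.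
  - intros s Hs; apply Hdecision, Hd, in_flat_map; exists (k, l); split; auto.
    now apply in_map.
  - intros t Ht; apply Hterm; eapply rule_arith_occs_body; eauto.
  - apply Hl; now apply (in_map (fun '(k, l) => rw_lit SP k l) _ (k, l)).
Qed.

(** * Projecting to one example and lifting rule instances *)

Definition project (M : interp tname) (i : nat) : interp string := fun g =>
  M (TOrd (fst g) (length (snd g)), e_val SP (gatom_pred g) (ident i) ++ snd g).

(** The value for [VRes j]. The default [Num 0] is met only for an identifier absent from the rule
    or an undefined operation, and an instance with an undefined operation is discarded anyway. *)
Definition result (sigma : string -> const) (r : srule) (j : nat) : const :=
  match find (fun o => Nat.eqb (fst (fst o)) j) (rule_arith_occs r) with
  | Some (_, u, v) =>
      match eval sigma (term_inst theta (SkBin j u v)) with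
      | Some c => c
      | None => Num 0
      end
  | None => Num 0
  end.

Definition extend (sigma : string -> const) (i : nat) (r : srule) (x : tvar)
  : const :=
  match x with
  | VOrig y => sigma y
  | VE => ident i
  | VDec _ s => val_const s (theta s)
  | VRes j => result sigma r j
  | VX _ => Num 0
  end.

Lemma result_spec sigma r j u v c :
  In r P -> In (j, u, v) (rule_arith_occs r) ->
  eval sigma (term_inst theta (SkBin j u v)) = Some c -> result sigma r j = c.
Proof.
  intros Hr Ho E; unfold result.
  destruct (find _ (rule_arith_occs r)) as [[[j' u'] v']|] eqn:Ef.
  - apply find_some in Ef as [Hin Hj]; apply Nat.eqb_eq in Hj; simpl in Hj; subst j'.
    assert ((j, u', v') = (j, u, v)) as [= -> ->].
    { eapply arith_occurrence_unique; eauto. }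
    now rewrite E.
  - apply (find_none _ _ Ef) in Ho; simpl in Ho; now rewrite Nat.eqb_refl in Ho.
Qed.

Lemma lit_terms_defined (J M : interp string) sigma l t :
  lit_holds J M sigma (lit_inst theta l) -> In t (lit_terms l) ->
  exists c, eval sigma (term_inst theta t) = Some c.
Proof.
  assert (Hatom : forall a g, ground_atom sigma (atom_inst theta a) = Some g ->
    In t (saargs a) -> exists c, eval sigma (term_inst theta t) = Some c).
  { intros a g Eg Ht; unfold ground_atom, atom_inst in Eg; simpl in Eg.
    destruct (eval_list sigma (map (term_inst theta) (saargs a))) eqn:E;
      [|discriminate].
    eapply eval_list_defined; eauto; now apply in_map. }
  destruct l as [sg a|o u v|j u v]; simpl.
  - intros H Ht; destruct sg as [| |j]; [| |destruct (theta (SNot j))];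
      destruct H as (g & Eg & _); eauto.
  - intros (c & d & Eu & Ev & _) [<-|[<-|[]]]; eauto.
  - intros (c & d & Eu & Ev & _) [<-|[<-|[]]]; eauto.
Qed.

Section Up.

Context (M J : interp tname) (i : nat).
Context (Hclosed : rw_closed M J) (Hi : valid i).
Context (Hdec : forall s, In s (svars P) ->
  J (TDecision s, [val_const s (theta s)])).
(** Closure bounds reified atoms from below only, while a negated sketched atom needs every reified
    atom of [M] to have a source. For a glued [M] this is read off the construction; for an answer
    set it comes from [stable_supported]. *)
Context (Hneg : forall q n d cs, In (SPred q n) (svars P) -> length cs = n ->
  M (TReified (SPred q n), e_val SP (PSk q n) (ident i) ++ Sym d :: cs) ->
  project M i (d, cs)).

Lemma examples_up : J (TExamples, [ident i]).
Proof. destruct Hi as (b & e & H); eapply rw_closed_example; eauto. Qed.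

(** Opposite implications for the two polarities: a positive literal needs its rewritten atom in
    [J], a negated one needs the presence of its rewritten atom in [M] to imply that of the instance
    atom. *)
Lemma app_up r l sg a k sigma cs :
  In r P -> In l (sbody r) -> l = SLit sg a -> length cs = length (saargs a) ->
  (project J i (aname (atom_inst theta a), cs) ->
   J (app_name (saname a) (length (saargs a)),
      e_val SP (satom_pred a) (ident i) ++
      dec_val (extend sigma i r) k (saname a) (length (saargs a)) ++ cs)) /\
  (M (app_name (saname a) (length (saargs a)),
      e_val SP (satom_pred a) (ident i) ++
      dec_val (extend sigma i r) k (saname a) (length (saargs a)) ++ cs) ->
   project M i (aname (atom_inst theta a), cs)).
Proof.
  intros Hr Hl -> Hn; unfold project, satom_pred, atom_inst, gatom_pred; simpl.
  destruct (saname a) as [p|q] eqn:Ea; simpl; rewrite Hn; [tauto|].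
  assert (Hs : In (SPred q (length (saargs a))) (svars P)).
  { eapply lit_svars_svars; eauto; unfold lit_svars, atom_svars; rewrite Ea.
    destruct sg; simpl; auto. }
  split.
  - intros H; apply (rw_closed_pred Hclosed); auto.
    + exact (Htheta _ Hs).
    + intros _; apply examples_up.
  - intros H; apply Hneg in H; auto.
    unfold project, gatom_pred in H; simpl in H; now rewrite Hn in H.
Qed.

Lemma lit_holds_up r l k sigma :
  In r P -> In l (sbody r) ->
  (forall t, In t (lit_terms l) ->
     eval (extend sigma i r) (rw_term t) = eval sigma (term_inst theta t)) ->
  lit_holds (project J i) (project M i) sigma (lit_inst theta l) ->
  lit_holds J M (extend sigma i r) (rw_lit SP k l).
Proof.
  intros Hr Hl Ht H.
  destruct l as [sg a|o t u|j t u].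
  - assert (Hargs : forall g, ground_atom sigma (atom_inst theta a) = Some g ->
      exists cs, eval_list (extend sigma i r) (map rw_term (saargs a)) = Some cs /\
        length cs = length (saargs a) /\ g = (aname (atom_inst theta a), cs)).
    { intros g Eg; unfold ground_atom in Eg; simpl aargs in Eg.
      rewrite <- (eval_list_map_ext (extend sigma i r) sigma rw_term (term_inst theta)
        (saargs a) Ht) in Eg.
      destruct (eval_list (extend sigma i r) (map rw_term (saargs a))) as [cs|] eqn:E;
        [|discriminate].
      injection Eg as <-; exists cs; repeat split.
      rewrite (eval_list_length _ _ E); apply length_map. }
    assert (Hground : forall cs,
      eval_list (extend sigma i r) (map rw_term (saargs a)) = Some cs ->
      ground_atom (extend sigma i r) (rw_atom SP k a) =
      Some (app_name (saname a) (length (saargs a)),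
            e_val SP (satom_pred a) (ident i) ++
            dec_val (extend sigma i r) k (saname a) (length (saargs a)) ++ cs)).
    { intros cs E; unfold rw_atom; rewrite (ground_rw_app _ _ _ _ _ E).
      now rewrite length_map. }
    assert (Hdc : dec_val (extend sigma i r) k (saname a) (length (saargs a)) =
      match saname a with
      | Ord _ => []
      | Sk _ => [match saname a with
                 | Ord _ => Num 0
                 | Sk q => Sym (theta (SPred q (length (saargs a))))
                 end]
      end) by now destruct (saname a).
    destruct sg as [| |j]; simpl in H |- *.
    + destruct H as (g & Eg & Hg); apply Hargs in Eg as (cs & Ec & Hn & ->).
      eexists; split; [eauto|]; eapply app_up; eauto.
    + destruct H as (g & Eg & Hg); apply Hargs in Eg as (cs & Ec & Hn & ->).
      eexists; split; [eauto|]; intros HM; apply Hg; eapply app_up; eauto.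
    + assert (Hgn : forall cs,
        eval_list (extend sigma i r) (map rw_term (saargs a)) = Some cs ->
        ground_atom (extend sigma i r) (Atom (TReified (SNot j))
          (e_arg SP (satom_pred a) ++ Var (VDec k (SNot j)) ::
           dec_arg k (saname a) (length (saargs a)) ++ map rw_term (saargs a))) =
        Some (TReified (SNot j), e_val SP (satom_pred a) (ident i) ++
          nval_const (theta (SNot j)) ::
          dec_val (extend sigma i r) k (saname a) (length (saargs a)) ++ cs)).
      { intros cs E; unfold ground_atom; simpl.
        rewrite eval_list_app, eval_e_arg; simpl.
        now rewrite eval_list_app, eval_dec_arg, E. }
      destruct (theta (SNot j)) eqn:Ev; simpl in H;
        destruct H as (g & Eg & Hg); apply Hargs in Eg as (cs & Ec & Hn & ->);
        eexists; (split; [eauto|]); rewrite Hdc.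
      * apply (rw_closed_pos Hclosed) with r; auto.
        -- intros _; apply examples_up.
        -- rewrite <- Hdc; eapply app_up; eauto.
      * apply (rw_closed_neg Hclosed) with r; auto.
        -- intros _; apply examples_up.
        -- rewrite <- Hdc; intros HM; apply Hg; eapply app_up; eauto.
  - simpl in H, Ht |- *; rewrite !Ht by auto; exact H.
  - simpl in H, Ht |- *; destruct H as (c & d & Et & Eu & Ho).
    unfold ground_atom; simpl; rewrite !Ht, Et, Eu by auto; simpl.
    eexists; split; [reflexivity|].
    apply (rw_closed_ineq Hclosed); auto.
    eapply lit_svars_svars; eauto; simpl; auto.
Qed.

(** The rewritten body contains a literal for every sketched operation of the rule, those of the
    head included. Hence head terms must be assumed defined; those of the body are so because its
    literals hold. *)
Lemma body_up r sigma :
  In r P ->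
  body_holds (project J i) (project M i) sigma (map (lit_inst theta) (sbody r)) ->
  (forall t, In t (head_terms (shead r)) ->
     exists c, eval sigma (term_inst theta t) = Some c) ->
  body_holds J M (extend sigma i r) (rw_body SP r) /\
  (forall t, In t (head_terms (shead r)) ->
     eval (extend sigma i r) (rw_term t) = eval sigma (term_inst theta t)).
Proof.
  intros Hr Hb Hh; unfold body_holds in Hb; rewrite Forall_forall in Hb.
  assert (Hdef : forall j u v, In (j, u, v) (rule_arith_occs r) ->
    eval sigma (term_inst theta (SkBin j u v)) = Some (result sigma r j)).
  { intros j u v Ho; pose proof Ho as Ho'; unfold rule_arith_occs in Ho'.
    apply in_flat_map in Ho' as (t & Ht & Hot).
    assert (exists c, eval sigma (term_inst theta t) = Some c) as [c Ec].
    { apply in_app_iff in Ht as [Ht|Ht]; auto.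
      apply in_flat_map in Ht as (l & Hl & Ht).
      eapply lit_terms_defined; eauto; apply Hb; now apply in_map. }
    destruct (arith_occs_defined _ _ _ _ _ _ Ec Hot) as [d Ed].
    rewrite Ed; f_equal; symmetry; eapply result_spec; eauto. }
  assert (Hterm : forall t, incl (arith_occs t) (rule_arith_occs r) ->
    eval (extend sigma i r) (rw_term t) = eval sigma (term_inst theta t)).
  { intros t Ht; apply eval_rw_term_of_values; intros j u v Ho.
    apply Hdef; auto. }
  assert (Hdl : forall k s, In s (svars P) ->
    lit_holds J M (extend sigma i r) (decision_lit k s)).
  { intros k s Hs; eexists; split; [reflexivity|]; simpl; auto. }
  split.
  - unfold rw_body; rewrite !body_holds_app; repeat split.
    + apply Forall_forall; intros l' Hl'.
      apply in_map_iff in Hl' as ([k l] & <- & Hl); apply In_places_inv in Hl.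
      apply lit_holds_up; auto; [|apply Hb; now apply in_map].
      intros t Ht; apply Hterm; eapply rule_arith_occs_body; eauto.
    + apply Forall_forall; intros l' Hl'; apply in_map_iff in Hl' as (s & <- & Hs).
      apply Hdl, in_flat_map; exists r; split; auto.
      unfold rule_svars; rewrite in_app_iff; auto.
    + apply Forall_forall; intros l' Hl'.
      apply in_flat_map in Hl' as ([k l] & Hl & Hl'); apply In_places_inv in Hl.
      apply in_map_iff in Hl' as (s & <- & Hs).
      apply Hdl; eapply lit_svars_svars; eauto.
    + apply Forall_forall; intros l' Hl'.
      apply in_flat_map in Hl' as ([[j u] v] & Ho & Hl').
      pose proof (arith_svars _ _ _ Hr Ho) as Hs; simpl in Hs.
      destruct Hl' as [<-|[<-|[]]]; [|now apply Hdl].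
      destruct (rule_arith_occs_incl _ _ _ _ Ho) as [Hu Hv].
      pose proof (Hdef _ _ _ Ho) as E.
      change (eval sigma (Bin (theta (SArith j)) (term_inst theta u)
        (term_inst theta v)) = Some (result sigma r j)) in E.
      apply eval_bin_defined in E as (a & b & z & Eu & Ev & Ez & Er).
      simpl; unfold ground_atom; simpl; rewrite !Hterm, Eu, Ev, Er by auto.
      eexists; split; [reflexivity|]; now apply (rw_closed_arith Hclosed).
    + apply body_holds_cons; split; [|apply body_holds_nil].
      eexists; split; [reflexivity|]; apply examples_up.
  - intros t Ht; apply Hterm; destruct (shead r) as [h|] eqn:Eh; [|destruct Ht].
    eapply rule_arith_occs_head; eauto.
Qed.

Lemma closed_up b e :
  labelled i b e -> closed (with_facts theta P e) (project M i) (project J i).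
Proof.
  intros He; apply closed_with_facts; split.
  - intros r h sigma g Hr Eh Eg Hb; destruct (Hheads _ Hr Eh) as [p Ep'].
    unfold ground_atom in Eg; simpl in Eg.
    destruct (eval_list sigma (map (term_inst theta) (saargs h))) as [cs|] eqn:Ec;
      [|discriminate].
    destruct (@body_up r sigma Hr Hb) as [HbT Ht].
    { rewrite Eh; simpl; intros t Ht; eapply eval_list_defined; eauto.
      now apply in_map. }
    rewrite Eh in Ht; simpl in Ht.
    assert (Hn : length cs = length (saargs h)).
    { rewrite (eval_list_length _ _ Ec); apply length_map. }
    rewrite <- (eval_list_map_ext (extend sigma i r) _ rw_term _ _ Ht) in Ec.
    injection Eg as <-; unfold project, gatom_pred; rewrite Ep'; simpl.
    eapply (rw_closed_rule Hclosed); eauto.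
    unfold rw_atom; rewrite (ground_rw_app _ _ _ _ _ Ec), Ep', length_map, Hn.
    reflexivity.
  - intros [p cs] Hg; unfold project, gatom_pred; simpl.
    unfold e_val; destruct (excluded_middle_informative _) as [Hp|Hp].
    + eapply (rw_closed_fact Hclosed); eauto.
    (* A predicate occurring in an example is in [SP], so the fact always carries its identifier. *)
    + destruct Hp; exists (POrd p (length cs)); split; auto.
      exists e, (p, cs); repeat split; auto.
      apply nth_error_In in He; rewrite in_app_iff, !in_map_iff in *.
      destruct He as [(e' & [= _ ->] & H)|(e' & [= _ ->] & H)]; auto.
Qed.

Lemma violated_up :
  violated theta P (project J i) (project M i) ->
  exists r sigma, In r P /\ shead r = None /\ sigma VE = ident i /\
    body_holds J M sigma (rw_body SP r).
Proof.
  intros (r & sigma & Hr & Eh & Hb); exists r, (extend sigma i r).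
  repeat split; auto; apply body_up; auto; rewrite Eh; intros t [].
Qed.

End Up.

(** Applied once with [M] glued from [A] and [B = A], and once with [M] a given answer set and [B]
    the least models. The last hypothesis handles the choice rules: in the reduct they derive only
    constants chosen by [M], which must encode [theta]. *)
Lemma closed_down A B M :
  coherent A -> coherent B ->
  (forall i b e, labelled i b e -> closed (with_facts theta P e) (A i) (B i)) ->
  (forall x n args, lift_app A x n args -> M (app_name x n, args)) ->
  (forall s c, In s (svars P) -> M (TDecision s, [c]) -> lift A B (TDom s, [c]) ->
     c = val_const s (theta s)) ->
  rw_closed M (lift A B).
Proof.
  intros HA HB HAB HM Hdec; constructor.
  - intros r h sigma g Hr Eh Eg Hb.
    destruct (@body_down A B M r sigma HA HB HM Hr Hb) as (i & Hi & HE & Ht & Hb').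
    destruct (Hheads _ Hr Eh) as [p Ep'].
    apply ground_rw_app_inv in Eg as (cs & Ec & Hn & ->).
    rewrite length_map, Ep', HE in *; simpl.
    exists i, cs; repeat split; auto.
    destruct Hi as (b & e & He); pose proof (HAB _ _ _ He) as Hcl.
    apply closed_with_facts in Hcl as [Hcl _].
    eapply Hcl; eauto; unfold ground_atom, atom_inst; simpl; rewrite Ep'.
    erewrite <- eval_list_map_ext; [now rewrite Ec|].
    intros t Hth; apply Ht; eapply rule_arith_occs_head; eauto.
  - intros r sigma Hr Eh Hb (j & e & He & Ej).
    destruct (@body_down A B M r sigma HA HB HM Hr Hb) as (i & Hi & HE & Ht & Hb').
    simpl in Ej; rewrite HE in Ej; injection Ej as Ej; apply Nat2Z.inj in Ej as ->.
    exists j, e; rewrite HE; repeat split; auto; red; eauto 6.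
  - intros i b e He; exists i; split; auto; red; eauto.
  - intros i [|] e He; exists i, e; auto.
  - intros i b e p cs He Hin; exists i, cs; repeat split.
    + red; eauto.
    + simpl; unfold e_val; destruct (excluded_middle_informative _) as [Hp|Hp]; auto.
      destruct Hp; exists (POrd p (length cs)); split; auto.
      exists e, (p, cs); repeat split; auto.
      apply nth_error_In in He; rewrite in_app_iff, !in_map_iff in *.
      destruct He as [(e' & [= _ ->] & H)|(e' & [= _ ->] & H)]; auto.
    + pose proof (HAB _ _ _ He) as Hcl; apply closed_with_facts in Hcl as [_ Hcl]; auto.
  - intros s v Hs Hv; simpl; split; eauto.
  - intros s c Hs HMc HJ; split; auto; simpl; f_equal; auto.
  - intros q n d c cs Hs Hd Hn Hc HJ.
    destruct (classic (SP (PSk q n))) as [Hp|Hp].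
    + destruct (Hc Hp) as (i & Hi & [= ->]).
      change (lift_app B (Ord d) n (e_val SP (POrd d n) (ident i) ++ cs)) in HJ.
      apply lift_app_ord in HJ; auto.
      apply (@lift_app_sk B i q n d cs); auto.
    (* Here [c] need not identify any example; the index is taken from the witness for the domain
       atom. *)
    + destruct HJ as (i & cs' & Hi & Hn' & E & H); simpl in E.
      apply e_val_app_inj in E as (<- & _); exists i, cs; repeat split; auto.
      exists d; simpl; rewrite !(e_val_not _ _ _ Hp); auto.
  - intros j o c d Hs Ho; split; simpl; eauto 6.
  - intros j o a b z Hs Ho; split; simpl; eauto 8.
  - intros r j a c d cs n dc Hr Ha Hn Hc HJ.
    exists r, a, c, d, cs; repeat split; auto.
    + intros Hp; destruct (Hc Hp) as (i & Hi & [= ->]); eauto.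
    + left; split; auto; now rewrite lift_app_name in HJ.
  - intros r j a c d cs n dc Hr Ha Hn Hc HJ.
    exists r, a, c, d, cs; repeat split; auto.
    + intros Hp; destruct (Hc Hp) as (i & Hi & [= ->]); eauto.
    + right; split; auto.
  - intros c; simpl; eexists; reflexivity.
Qed.

End Translation.


(** * The two directions *)

Section Correctness.

Context (P : sprogram) (D : pdomains) (Ep En : list example).
Context (Hocc : distinct_occurrences P) (Hheads : ordinary_heads P)
  (Hstrat : stratified P D).

Local Notation SP := (in_SP P D (Ep ++ En)).
Local Notation T := (rewriting P D Ep En).
Local Notation labelled := (labelled Ep En).
Local Notation valid := (valid Ep En).
Local Notation coherent := (coherent P D Ep En).

(** Total in [i], with the empty example at invalid indices, so that a stable model can be chosen at
    every index at once. *)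
Definition example_at (i : nat) : example :=
  match nth_error (map (pair true) Ep ++ map (pair false) En) i with
  | Some (_, e) => e
  | None => []
  end.

Lemma labelled_example_at i b e : labelled i b e -> example_at i = e.
Proof. unfold labelled, example_at; now intros ->. Qed.

Lemma labelled_In i (b : bool) e :
  labelled i b e -> In e (if b then Ep else En).
Proof.
  intros H; apply nth_error_In in H; rewrite in_app_iff, !in_map_iff in H.
  now destruct H as [(e' & [= <- <-] & H)|(e' & [= <- <-] & H)].
Qed.

Lemma In_labelled (b : bool) e :
  In e (if b then Ep else En) -> exists i, labelled i b e.
Proof.
  intros H; apply In_nth_error, in_app_iff; rewrite !in_map_iff.
  destruct b; eauto.
Qed.

Lemma nSP_dep_closed : dep_closed P D (fun p => ~ SP p).
Proof. intros p q Hp Hpq Hq; apply Hp; eapply SP_depends; eauto. Qed.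

Lemma example_at_SP i g : valid i -> In g (example_at i) -> SP (gatom_pred g).
Proof.
  intros (b & e & He) Hg; rewrite (labelled_example_at He) in Hg.
  exists (gatom_pred g); split; auto; exists e, g; repeat split; auto.
  apply in_app_iff; apply labelled_In in He; destruct b; auto.
Qed.

Lemma stable_coherent theta A :
  is_substitution P D theta ->
  (forall i, valid i -> stable (with_facts theta P (example_at i)) (A i)) ->
  coherent A.
Proof.
  intros Htheta HA i j g Hi Hj Hg.
  apply (@stable_agree P D theta Htheta Hheads Hstrat _ (example_at i) (example_at j)
    (A i) (A j) nSP_dep_closed); auto.
  intros g' Hg'; split; intros H; destruct Hg'; eauto using example_at_SP.
Qed.

Lemma answer_set_of_satisfying theta :
  satisfying P D Ep En theta -> exists M, answer_set T M.
Proof.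
  intros (Htheta & Hpos & Hneg).
  set (A := fun i => proj1_sig (constructive_indefinite_description _
    (stable_exists Htheta Hheads Hstrat (example_at i)))).
  assert (HA : forall i, stable (with_facts theta P (example_at i)) (A i)).
  { intros i; unfold A; now destruct (constructive_indefinite_description _ _). }
  assert (HAc : coherent A) by (eapply stable_coherent; eauto).
  set (M := lift P D Ep En theta A A).
  assert (HM : rw_closed P D Ep En M M).
  { apply closed_down; auto.
    - intros i b e He; rewrite <- (labelled_example_at He); apply stable_closed, HA.
    - intros x n args; apply lift_app_name.
    - intros s c _ [_ H] _; simpl in H; congruence. }
  assert (Hproj : forall i, valid i -> project P D Ep En M i = A i).
  { intros i Hi; extensionality g; apply propositional_extensionality.
    destruct g as [p cs]; now apply lift_app_ord. }
  (* The satisfaction of [theta] in the form seen by the rewriting: exactly the negative examples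
     violate a constraint. *)
  assert (Hviol : forall i b e, labelled i b e ->
    (violated theta P (A i) (A i) <-> b = false)).
  { intros i b e He; pose proof (HA i) as Hs; rewrite (labelled_example_at He) in Hs.
    pose proof (has_answer_set Htheta Hheads Hstrat _ Hs) as Has.
    apply labelled_In in He; destruct b; split; try discriminate; auto.
    - intros Hv; now apply Has in Hv; [|apply Hpos].
    - intros _; apply NNPP; intros Hv; apply (Hneg _ He), Has, Hv. }
  exists M; apply answer_set_stable; split; [|split].
  - apply choice_bounds_rewriting; intros s Hs; exists (val_const s (theta s)).
    split.
    + repeat split; simpl; eauto.
    + intros c [_ [_ Hc]]; simpl in Hc; congruence.
  - apply stable_of_closed; [now apply closed_rewriting|].
    intros g Hg J HJ; apply closed_rewriting in HJ.
    (* The reduct turns the choice rule into a definite rule for the chosen constant, whose domain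
       atom is a fact. *)
    assert (Hdec : forall s, In s (svars P) -> J (TDecision s, [val_const s (theta s)])).
    { intros s Hs; apply (rw_closed_decision HJ); auto.
      - split; simpl; auto.
      - apply (rw_closed_dom HJ); auto. }
    assert (Hnegs : forall i, valid i -> forall q n d cs,
      In (SPred q n) (svars P) -> length cs = n ->
      M (TReified (SPred q n), e_val SP (PSk q n) (ident i) ++ Sym d :: cs) ->
      project P D Ep En M i (d, cs)).
    { intros i Hi q n d cs Hs Hn HMq; rewrite Hproj by auto.
      change (lift_app P D Ep En A (Sk q) n
        (e_val SP (PSk q n) (ident i) ++ Sym d :: cs)) in HMq.
      now apply lift_app_sk in HMq. }
    (* The projection of [J] is closed for the reduct by [A i], hence contains the least such
       interpretation, which is [A i] by stability. *)
    assert (Hup : forall i g, valid i -> A i g -> project P D Ep En J i g).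
    { intros i g' Hi Hg'; pose proof Hi as (b & e & He).
      apply (HA i) in Hg'; apply Hg'; rewrite (labelled_example_at He), <- Hproj by auto.
      eapply closed_up; eauto. }
    assert (Happ : forall x n args, lift_app P D Ep En A x n args ->
      J (app_name x n, args)).
    { intros [p|q] n args (i & cs & Hi & <- & H).
      - destruct H as [-> H]; exact (Hup _ _ Hi H).
      - destruct H as (Hs & d & Hd & -> & H).
        apply (rw_closed_pred HJ); auto.
        + intros _; destruct Hi as (b & e & He); eapply (rw_closed_example HJ); eauto.
        + exact (Hup _ _ Hi H). }
    destruct g as [[p n| | | | |s|s|[q n|j|j|j]|] args]; unfold M, lift in Hg;
      simpl in Hg.
    + exact (Happ (Ord p) n args Hg).
    + destruct Hg as (i & (b & e & He) & ->); eapply (rw_closed_example HJ); eauto.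
    + destruct Hg as (i & e & He & ->); exact (rw_closed_label HJ He).
    + destruct Hg as (i & e & He & ->); exact (rw_closed_label HJ He).
    + destruct Hg as (i & e & He & -> & Hv).
      assert (Hi : valid i) by (red; eauto).
      destruct (@violated_up P D Ep En theta Hocc Htheta M J i HJ Hi Hdec
        (Hnegs i Hi)) as (r & sigma & Hr & Eh & E & Hb).
      { destruct Hv as (r & sigma & Hr & Eh & Hb); exists r, sigma.
        repeat split; auto; rewrite Hproj by auto.
        revert Hb; apply body_holds_mono; auto. }
      rewrite <- E; eapply (rw_closed_negsat HJ); eauto.
      rewrite E; exact (rw_closed_label HJ He).
    + destruct Hg as [Hs ->]; auto.
    + destruct Hg as (Hs & v & Hv & ->); apply (rw_closed_dom HJ); auto.
    + exact (Happ (Sk q) n args Hg).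
    + destruct Hg as (Hs & o & c & d & -> & Ho); apply (rw_closed_ineq HJ); auto.
    + destruct Hg as (Hs & o & a & b & z & -> & Ho); apply (rw_closed_arith HJ); auto.
    + destruct Hg as (r & a & c & d & cs & Hr & Ha & Hn & Hc & Hg).
      assert (Hex : SP (satom_pred a) -> J (TExamples, [c])).
      { intros Hp; destruct (Hc Hp) as (i & (b & e & He) & ->).
        eapply (rw_closed_example HJ); eauto. }
      destruct Hg as [[-> Hg]|[-> Hg]].
      * apply (rw_closed_pos HJ) with r; auto.
      * apply (rw_closed_neg HJ) with r; auto.
        intros H; apply Hg; now apply lift_app_name in H.
    + destruct Hg as [c ->]; apply (rw_closed_term HJ).
  - apply constraints_rewriting; split.
    + intros r sigma Hr Eh Hb (j & e & He & Ej); simpl in Ej; injection Ej as Ej.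
      destruct (@body_down P D Ep En theta Hocc Htheta A A M r sigma HAc HAc)
        as (i & Hi & HE & _ & Hb'); auto.
      { intros x n args; apply lift_app_name. }
      rewrite HE in Ej; apply ident_inj in Ej as ->.
      enough (true = false) by discriminate.
      apply (Hviol _ _ _ He); red; eauto.
    + intros c (i & e & He & Ec); simpl in Ec; injection Ec as ->.
      exists i, e; repeat split; auto; now apply (Hviol _ _ _ He).
Qed.

(** * From an answer set to a substitution *)

Definition default_value (s : svar) : value s :=
  match s return value s with
  | SPred _ _ => EmptyString
  | SIneq _ => CEq
  | SArith _ => Dist
  | SNot _ => NotAbsent
  end.

(** A substitution is total, also on sketched variables that do not occur in the program, so
    [epsilon] needs an arbitrary inhabitant; for the occurring ones [decoded_spec] shows that the
    choice succeeds. *)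
Definition decoded (M : interp tname) : subst := fun s =>
  epsilon (inhabits (default_value s))
    (fun v => In v (domain D s) /\ M (TDecision s, [val_const s v])).

(** The two kinds of atom whose source matters: domain atoms, so that a decision encodes a value of
    the domain, and reified sketched atoms, so that their negation transfers to the instance. *)
Definition dom_reified_supported (M : interp tname) (g : gatom tname) : Prop :=
  match fst g with
  | TDom s => exists v, In v (domain D s) /\ snd g = [val_const s v]
  | TReified (SPred q n) => exists c d cs,
      In d (D q n) /\ snd g = e_val SP (PSk q n) c ++ Sym d :: cs /\
      M (TOrd d n, e_val SP (POrd d n) c ++ cs)
  | _ => True
  end.

(** The supported atoms of [M] are closed for the reduct by [M], and [M] is the least closed
    interpretation. *)
Lemma stable_supported M :
  stable T M -> forall g, M g -> dom_reified_supported M g.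
Proof.
  intros HM g Hg.
  enough (M g /\ dom_reified_supported M g) by tauto.
  pose proof (stable_closed HM) as Hcl; apply closed_rewriting in Hcl.
  apply HM in Hg; apply (Hg (fun g => M g /\ dom_reified_supported M g)).
  clear g Hg; apply closed_rewriting; constructor.
  - intros r h sigma g Hr Eh Eg Hb; split.
    + eapply (rw_closed_rule Hcl); eauto; revert Hb; apply body_holds_mono; tauto.
    + destruct (Hheads _ Hr Eh) as [p Ep'].
      apply ground_rw_app_inv in Eg as (cs & _ & _ & ->); now rewrite Ep'.
  - intros r sigma Hr Eh Hb [HN _]; split; [|exact I].
    eapply (rw_closed_negsat Hcl); eauto; revert Hb; apply body_holds_mono; tauto.
  - intros i b e He; split; [|exact I]; eapply (rw_closed_example Hcl); eauto.
  - intros i b e He; split; [exact (rw_closed_label Hcl He)|now destruct b].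
  - intros i b e p cs He Hin; split; [|exact I]; eapply (rw_closed_fact Hcl); eauto.
  - intros s v Hs Hv; split; [now apply (rw_closed_dom Hcl)|red; simpl; eauto].
  - intros s c Hs HD [HJ _]; split; [now apply (rw_closed_decision Hcl)|exact I].
  - intros q n d c cs Hs Hd Hn Hc [HJ _]; split.
    + apply (rw_closed_pred Hcl); auto; intros Hp; apply (Hc Hp).
    + exists c, d, cs; auto.
  - intros i o c d Hs Ho; split; [now apply (rw_closed_ineq Hcl)|exact I].
  - intros i o a b z Hs Ho; split; [now apply (rw_closed_arith Hcl)|exact I].
  - intros r i a c d cs n dc Hr Ha Hn Hc [HJ _]; split; [|exact I].
    apply (rw_closed_pos Hcl) with r; auto; intros Hp; apply (Hc Hp).
  - intros r i a c d cs n dc Hr Ha Hn Hc HJ; split; [|exact I].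
    apply (rw_closed_neg Hcl) with r; auto; intros Hp; apply (Hc Hp).
  - intros c; split; [apply (rw_closed_term Hcl)|exact I].
Qed.

Lemma decoded_spec M s :
  answer_set T M -> In s (svars P) ->
  In (decoded M s) (domain D s) /\ M (TDecision s, [val_const s (decoded M s)]) /\
  forall c, M (TDom s, [c]) -> M (TDecision s, [c]) -> c = val_const s (decoded M s).
Proof.
  intros HM Hs; apply answer_set_stable in HM as (Hb & Hst & _).
  pose proof (stable_closed Hst) as Hcl; apply closed_rewriting in Hcl.
  apply (proj1 (choice_bounds_rewriting _ _ _ _ _)) with (s := s) in Hb; auto.
  destruct Hb as (c & [Hdom Hdec] & Huniq).
  destruct (stable_supported Hst _ Hdom) as (v & Hv & [= ->]).
  unfold decoded; set (X := fun v => _ /\ _).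
  assert (X (epsilon (inhabits (default_value s)) X)) as [H1 H2].
  { apply epsilon_spec; exists v; now split. }
  repeat split; auto; intros c Hc Hc'.
  rewrite <- (Huniq c) by auto; apply Huniq; split; auto.
  now apply (rw_closed_dom Hcl).
Qed.

Lemma satisfying_of_answer_set M :
  answer_set T M -> satisfying P D Ep En (decoded M).
Proof.
  intros HM; set (theta := decoded M).
  pose proof (fun s => @decoded_spec M s HM) as Hspec; fold theta in Hspec.
  apply answer_set_stable in HM as (_ & HM & Hcon).
  apply constraints_rewriting in Hcon as [Hcon Hnegsat].
  pose proof (stable_closed HM) as Hcl; apply closed_rewriting in Hcl.
  assert (Htheta : is_substitution P D theta) by (intros s Hs; now apply Hspec).
  set (A := project P D Ep En M).
  set (B := fun i => least (with_facts theta P (example_at i)) (A i)).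
  assert (Hdec : forall s, In s (svars P) -> M (TDecision s, [val_const s (theta s)])).
  { intros s Hs; now apply Hspec. }
  assert (Hneg : forall i q n d cs, In (SPred q n) (svars P) -> length cs = n ->
    M (TReified (SPred q n), e_val SP (PSk q n) (ident i) ++ Sym d :: cs) ->
    A i (d, cs)).
  { intros i q n d cs Hs Hn H.
    destruct (stable_supported HM _ H) as (c & d' & cs' & Hd & E & H').
    simpl in E; apply e_val_app_inj in E as ([= <- <-] & _ & Ec).
    unfold A, project, gatom_pred; simpl; rewrite Hn.
    destruct (classic (SP (PSk q n))) as [Hp|Hp].
    - now rewrite (Ec Hp).
    (* Without the identifier the support may stem from another value [c] of E, but then [d] is
       outside [SP] too and its atom does not mention [c]. *)
    - assert (Hp' : ~ SP (POrd d n)) by (intros Hd'; apply Hp; eapply SP_domain; eauto).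
      rewrite e_val_not in H' |- * by auto; exact H'. }
  assert (HA : forall i b e, labelled i b e -> closed (with_facts theta P e) (A i) (A i)).
  { intros i b e He; assert (Hi : valid i) by (red; eauto).
    refine (closed_up Hocc Hheads Htheta Hcl Hi Hdec _ He); apply Hneg. }
  assert (HBA : forall i g, valid i -> B i g -> A i g).
  { intros i g (b & e & He) Hg; apply Hg; rewrite (labelled_example_at He); eauto. }
  assert (HAc : coherent A).
  { intros i j g _ _ Hg; unfold A, project; now rewrite !e_val_not. }
  (* The reducts are taken by different [A i], but these agree outside [SP], no example adds an atom
     there, and the complement of [SP] is closed under dependencies. *)
  assert (HBc : coherent B).
  { intros i j g Hi Hj Hg; destruct (depth_bounded Hstrat) as [n Hn].
    eapply (@least_agree P D theta Htheta Hheads) with (n := n) (1 := nSP_dep_closed).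
    - intros g' Hg' Hin; destruct Hg'; exact (example_at_SP _ Hi Hin).
    - intros g' Hg' _; apply HAc; auto.
    - exact Hg.
    - apply Hn; lia. }
  assert (Happ : forall x n args, lift_app P D Ep En A x n args ->
    M (app_name x n, args)).
  { intros [p|q] n args (i & cs & Hi & <- & H).
    - destruct H as [-> H]; exact H.
    - destruct H as (Hs & d & Hd & -> & H); apply (rw_closed_pred Hcl); auto.
      intros _; destruct Hi as (b & e & He); eapply (rw_closed_example Hcl); eauto. }
  (* Minimality is spent on all atoms of [M] at once: on ordinary atoms it gives stability of [A i],
     on [negsat] the violated constraint of a negative example. *)
  assert (Hlift : forall g, M g -> lift P D Ep En theta A B g).
  { intros g Hg; apply HM in Hg; apply Hg; apply closed_rewriting, closed_down; auto.
    - intros i b e He; unfold B; rewrite (labelled_example_at He); apply closed_least.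
    - intros s c Hs Hc (_ & v & Hv & [= ->]); apply Hspec; auto.
      now apply (rw_closed_dom Hcl). }
  assert (Hst : forall i b e, labelled i b e -> stable (with_facts theta P e) (A i)).
  { intros i b e He; apply stable_of_closed; [eauto|].
    intros [p cs] Hg; rewrite <- (labelled_example_at He).
    assert (Hi : valid i) by (red; eauto).
    apply (@lift_app_ord P D Ep En B i p _ cs HBc Hi eq_refl); exact (Hlift _ Hg). }
  split; [exact Htheta|split].
  - intros e He; destruct (@In_labelled true e He) as [i Hi].
    apply (has_answer_set Htheta Hheads Hstrat _ (Hst _ _ _ Hi)); intros Hv.
    assert (Hval : valid i) by (red; eauto).
    destruct (@violated_up P D Ep En theta Hocc Htheta M M i Hcl Hval Hdec (Hneg i) Hv)
      as (r & sigma & Hr & Eh & E & Hb).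
    apply (Hcon r sigma Hr Eh Hb); rewrite E; exact (rw_closed_label Hcl Hi).
  - intros e He; destruct (@In_labelled false e He) as [i Hi].
    intros H; apply (has_answer_set Htheta Hheads Hstrat _ (Hst _ _ _ Hi)) in H; apply H.
    (* The violation is found with its positive part in [B i]; the inclusion of [B i] in [A i] moves
       it to the stable model. *)
    pose proof (Hlift _ (Hnegsat _ (rw_closed_label Hcl Hi))) as (j & e' & Hj & E & Hv).
    simpl in E; injection E as E; apply Nat2Z.inj in E as ->.
    destruct Hv as (r & sigma & Hr & Eh & Hb); exists r, sigma; repeat split; auto.
    revert Hb; apply body_holds_mono; auto; intros g; apply HBA; red; eauto.
Qed.

End Correctness.

Theorem theorem1 (P : sprogram) (D : pdomains) (f : subst -> Z)
    (Ep En : list example)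
    (Hocc : distinct_occurrences P)
    (Hheads : ordinary_heads P)
    (Hstrat : stratified P D) :
  (exists theta : subst, satisfying P D Ep En theta) <->
  (exists M : interp tname, answer_set (rewriting P D Ep En) M).
Proof.
  split.
  - intros [theta H]; eapply answer_set_of_satisfying; eauto.
  - intros [M H]; exists (decoded D M); eapply satisfying_of_answer_set; eauto.
Qed.
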